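(* Let $(A,\Delta)$ be a multiplier Hopf $^*$-algebra with positive integrals and let $B$ be its dual $\hat A$ with the opposite comultiplication. Let $\mathcal{H}$ and $\hat{\mathcal{H}}$ be the G.N.S. Hilbert spaces of the positive left integrals $\varphi$ on $A$ and $\varphi$ on $B$. Then the Fourier transform $F:A\to B$, $F(a)=\varphi(\,\cdot\,a)$, gives (via $\eta(a)\mapsto\hat\eta(F(a))$) an isometry of $\mathcal{H}$ onto $\hat{\mathcal{H}}$, and it transforms the operators $\pi(a)$ and $\lambda(b)$ on $\mathcal{H}$ to, respectively, $\lambda(a)$ and $\pi(b)$ on $\hat{\mathcal{H}}$; that is, $F\pi(a)F^{-1}=\lambda(a)$ and $F\lambda(b)F^{-1}=\pi(b)$ for all $a\in A$, $b\in B$.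
   Context: Algebras are over $\mathbb{C}$, possibly without identity, with non-degenerate product; $M(A)$ is the multiplier algebra of $A$ and $\iota$ is the identity map. A multiplier Hopf $^*$-algebra is a pair $(A,\Delta)$ of a $^*$-algebra $A$ (non-degenerate product) and a comultiplication $\Delta$ (a $^*$-homomorphism $\Delta:A\to M(A\otimes A)$ that is non-degenerate, i.e. $\Delta(A)(A\otimes A)=A\otimes A$, and coassociative, $(\Delta\otimes\iota)\Delta=(\iota\otimes\Delta)\Delta$) such that the maps $a\otimes a'\mapsto\Delta(a)(1\otimes a')$ and $a\otimes a'\mapsto(a\otimes1)\Delta(a')$ are injective on $A\otimes A$ with range $A\otimes A$. It has a unique counit $\varepsilon$ (a $^*$-homomorphism $A\to\mathbb{C}$) and a unique antipode $S$ (a bijective anti-homomorphism with $S(S(a)^* )^*=a$). A left integral is a non-zero functional $\varphi$ with $(\iota\otimes\varphi)\Delta(a)=\varphi(a)1$ (in $M(A)$); a right integral is a non-zero functional $\psi$ with $(\psi\otimes\iota)\Delta(a)=\psi(a)1$. Positive means $\varphi(a^*a)\ge0$ for all $a$. Integrals are unique up to a scalar and faithful. ''With positive integrals'' means a positive left and a positive right integral exist. Dual: $\hat A=\{\varphi(\,\cdot\,a):a\in A\}$ in the linear dual of $A$, with $\varphi$ a fixed positive left integral. $B$ denotes $\hat A$ as a $^*$-algebra with the opposite of the dual comultiplication. Writing $\langle a,b\rangle=b(a)$, the structure of $B$ is given by $\langle a,bb'\rangle=\langle a_{(1)},b\rangle\langle a_{(2)},b'\rangle$, $\langle aa',b\rangle=\langle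 a,b_{(2)}\rangle\langle a',b_{(1)}\rangle$, $\langle a,b^*\rangle=\overline{\langle S(a)^*,b\rangle}$, $\langle S(a),b\rangle=\langle a,S^{-1}(b)\rangle$. $B$ is again a multiplier Hopf $^*$-algebra with positive integrals; its positive left integral, again denoted $\varphi$, is normalized by $\varphi(b)=\varepsilon(a)$ when $b=\varphi(\,\cdot\,a)$. Sweedler notation is used, a leg being covered by multiplication or through the pairing. G.N.S. spaces: $\mathcal{H}$ is the completion of $A$ for the scalar product $(x',x)\mapsto\varphi(x^*x')$ with canonical imbedding $\eta:A\to\mathcal{H}$; $\hat{\mathcal{H}}$, $\hat\eta$ are the same objects for $\varphi$ on $B$. The operators are the bounded operators (boundedness is known) determined by: on $\mathcal{H}$, $\pi(a)\eta(x)=\eta(ax)$ and $\lambda(b)\eta(x)=\langle S^{-1}(x_{(1)}),b\rangle\eta(x_{(2)})$; on $\hat{\mathcal{H}}$, $\pi(b)\hat\eta(y)=\hat\eta(by)$ and $\lambda(a)\hat\eta(y)=\langle a,y_{(1)}\rangle\hat\eta(y_{(2)})$, for $a,x\in A$, $b,y\in B$. *)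

(* Defs.v *)
From HB Require Import structures.
From mathcomp Require Import all_boot all_order all_algebra.
From mathcomp Require Import all_classical all_reals all_analysis.
From mathcomp Require Import complex.

Set Implicit Arguments.
Unset Strict Implicit.
Unset Printing Implicit Defensive.

Import Order.TTheory GRing.Theory Num.Theory numFieldNormedType.Exports.
Local Open Scope quotient_scope.
Local Open Scope ring_scope.

Reserved Notation "x ** y" (at level 40, left associativity).
Reserved Notation "u ⊗ v" (at level 45, left associativity).

Definition bilin (K : pzRingType) (U V W : lmodType K) (f : U -> V -> W) :=
  (forall v, linear (f^~ v)) /\ (forall u, linear (f u)).

Section LinearFacts.
Variables (K : pzRingType) (U V : lmodType K) (f : U -> V).
Hypothesis fl : linear f.

Lemma lin0 : f 0 = 0.
Proof. by have := fl (-1) 0 0; rewrite scaler0 addr0 scaleN1r addNr. Qed.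
Lemma linZ c u : f (c *: u) = c *: f u.
Proof. by have := fl c u 0; rewrite !addr0 lin0 addr0. Qed.
Lemma linD u v : f (u + v) = f u + f v.
Proof. by have := fl 1 u v; rewrite !scale1r. Qed.
Lemma lin_sum I (s : seq I) (F : I -> U) :
  f (\sum_(i <- s) F i) = \sum_(i <- s) f (F i).
Proof. exact: (big_morph f linD lin0). Qed.
End LinearFacts.

(* The algebraic tensor product: formal sums of pairs, two of them being       *)
(* identified when every bilinear map takes the same value on both.            *)
Section Tensor.
Variables (K : comPzRingType) (U V : lmodType K).

Definition formal_eval (W : lmodType K) (f : U -> V -> W) (s : seq (U * V)) : W :=
  \sum_(p <- s) f p.1 p.2.

Definition tensor_eqv (s t : seq (U * V)) : bool :=
  `[< forall (W : lmodType K) (f : U -> V -> W), bilin f ->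
        formal_eval f s = formal_eval f t >].

Lemma tensor_eqv_refl : reflexive tensor_eqv.
Proof. by move=> s; apply/asboolP. Qed.

Lemma tensor_eqv_sym : symmetric tensor_eqv.
Proof.
by move=> s t; apply/asboolP/asboolP => h W f fb; rewrite (h W f fb).
Qed.

Lemma tensor_eqv_trans : transitive tensor_eqv.
Proof.
move=> t s r /asboolP st /asboolP tr; apply/asboolP => W f fb.
by rewrite st // tr.
Qed.

Canonical tensor_equiv :=
  EquivRel tensor_eqv tensor_eqv_refl tensor_eqv_sym tensor_eqv_trans.

Definition tensor := {eq_quot tensor_equiv}.
HB.instance Definition _ := Choice.on tensor.
HB.instance Definition _ := EqQuotient.on tensor.

(* The map induced by f on the tensor product; independent of the chosen       *)
(* representative when f is bilinear.                                          *)
Definition tlift (W : lmodType K) (f : U -> V -> W) (t : tensor) : W :=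
  formal_eval f (repr t).

Definition pure (u : U) (v : V) : tensor := \pi_tensor [:: (u, v)].

Lemma tlift_pi (W : lmodType K) (f : U -> V -> W) s : bilin f ->
  tlift f (\pi_tensor s) = formal_eval f s.
Proof.
move=> fb; rewrite /tlift.
have /eqmodP /asboolP h : repr (\pi_tensor s) = s %[mod tensor] by rewrite reprK.
exact: h.
Qed.

Lemma tensor_ext (s t : tensor) :
  (forall (W : lmodType K) (f : U -> V -> W), bilin f -> tlift f s = tlift f t) ->
  s = t.
Proof.
move=> h; rewrite -(reprK s) -(reprK t); apply/eqmodP/asboolP => W f fb.
exact: h.
Qed.

Lemma tlift_pure (W : lmodType K) (f : U -> V -> W) u v : bilin f ->
  tlift f (pure u v) = f u v.
Proof. by move=> fb; rewrite tlift_pi // /formal_eval big_seq1. Qed.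

Definition tzero : tensor := \pi_tensor [::].
Definition tadd (s t : tensor) : tensor := \pi_tensor (repr s ++ repr t).
Definition tscale (c : K) (t : tensor) : tensor :=
  \pi_tensor [seq (c *: p.1, p.2) | p <- repr t].
Definition topp (t : tensor) : tensor := tscale (-1) t.

Section Lift.
Variables (W : lmodType K) (f : U -> V -> W) (fb : bilin f).

Lemma tlift0 : tlift f tzero = 0.
Proof. by rewrite tlift_pi // /formal_eval big_nil. Qed.

Lemma tliftD s t : tlift f (tadd s t) = tlift f s + tlift f t.
Proof. by rewrite tlift_pi // /formal_eval big_cat. Qed.

Lemma tliftZ c t : tlift f (tscale c t) = c *: tlift f t.
Proof.
rewrite tlift_pi // /tlift /formal_eval big_map scaler_sumr.
by apply: eq_bigr => p _ /=; rewrite (linZ (fb.1 p.2)).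
Qed.

Lemma tliftN t : tlift f (topp t) = - tlift f t.
Proof. by rewrite tliftZ scaleN1r. Qed.
End Lift.

Lemma taddA : associative tadd.
Proof. by move=> s t r; apply: tensor_ext => W f fb; rewrite !tliftD // addrA. Qed.
Lemma taddC : commutative tadd.
Proof. by move=> s t; apply: tensor_ext => W f fb; rewrite !tliftD // addrC. Qed.
Lemma tadd0 : left_id tzero tadd.
Proof. by move=> s; apply: tensor_ext => W f fb; rewrite tliftD // tlift0 // add0r. Qed.
Lemma taddN : left_inverse tzero topp tadd.
Proof.
move=> s; apply: tensor_ext => W f fb.
by rewrite tliftD // tliftN // tlift0 // addNr.
Qed.

HB.instance Definition _ := GRing.isZmodule.Build tensor taddA taddC tadd0 taddN.

Lemma tscaleA a b t : tscale a (tscale b t) = tscale (a * b) t.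
Proof. by apply: tensor_ext => W f fb; rewrite !tliftZ // scalerA. Qed.
Lemma tscale1 : left_id 1 tscale.
Proof. by move=> t; apply: tensor_ext => W f fb; rewrite !tliftZ // scale1r. Qed.
Lemma tscaleDr : right_distributive tscale +%R.
Proof.
move=> c s t; apply: tensor_ext => W f fb.
by rewrite !(tliftZ, tliftD) // scalerDr.
Qed.
Lemma tscaleDl t : {morph tscale^~ t : a b / a + b}.
Proof.
move=> a b; apply: tensor_ext => W f fb.
by rewrite !(tliftZ, tliftD) // scalerDl.
Qed.

HB.instance Definition _ :=
  GRing.Zmodule_isLmodule.Build K tensor tscaleA tscale1 tscaleDr tscaleDl.

Lemma tlift_linear (W : lmodType K) (f : U -> V -> W) : bilin f -> linear (tlift f).
Proof. by move=> fb c s t; rewrite tliftD // tliftZ. Qed.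

Lemma pure_bilin : bilin pure.
Proof.
split=> [v c u u'|u c v v']; apply: tensor_ext => W f fb.
  by rewrite tlift_linear // !tlift_pure // fb.1.
by rewrite tlift_linear // !tlift_pure // fb.2.
Qed.

Lemma tensorE t : t = \sum_(p <- repr t) pure p.1 p.2.
Proof.
apply: tensor_ext => W f fb; rewrite (lin_sum (tlift_linear fb)).
by apply: eq_bigr => p _; rewrite tlift_pure.
Qed.

Lemma tlift_lincomb (W : lmodType K) (f g h : U -> V -> W) c t :
  (forall u v, f u v = c *: g u v + h u v) ->
  tlift f t = c *: tlift g t + tlift h t.
Proof.
move=> e; rewrite /tlift /formal_eval scaler_sumr -big_split /=.
by apply: eq_bigr.
Qed.

Lemma eq_linear_tensor (W : lmodType K) (f g : tensor -> W) :
  linear f -> linear g -> (forall u v, f (pure u v) = g (pure u v)) -> f =1 g.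
Proof.
move=> fl gl fg t; rewrite (tensorE t) (lin_sum fl) (lin_sum gl).
exact: eq_bigr.
Qed.

End Tensor.

Notation "u ⊗ v" := (pure u v) : ring_scope.

HB.mixin Record isNUAlgebra (K : pzRingType) A of GRing.Lmodule K A := {
  nmul : A -> A -> A;
  nmulA : associative nmul;
  nmul_bilin : bilin nmul
}.

#[short(type="nuAlgType")]
HB.structure Definition NUAlgebra (K : pzRingType) :=
  {A of GRing.Lmodule K A & isNUAlgebra K A}.

Notation "x ** y" := (nmul x y) : ring_scope.

Definition nondegenerate_product (K : pzRingType) (A : nuAlgType K) :=
  (forall x : A, (forall y, x ** y = 0) -> x = 0) /\
  (forall x : A, (forall y, y ** x = 0) -> x = 0).

Section TensorAlgebra.
Variables (K : comPzRingType) (A B : nuAlgType K).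
Local Notation T := (tensor A B).

Definition tmul (s t : T) : T :=
  tlift (fun a b => tlift (fun c d => (a ** c) ⊗ (b ** d)) t) s.

Lemma tmul_bilin_inner a b : bilin (fun (c : A) (d : B) => (a ** c) ⊗ (b ** d)).
Proof.
split=> [d e c c'|c e d d'].
  by rewrite (nmul_bilin.2) ((pure_bilin _ _).1).
by rewrite (nmul_bilin.2) ((pure_bilin _ _).2).
Qed.

Lemma tmul_bilin_outer (t : T) :
  bilin (fun a b => tlift (fun c d => (a ** c) ⊗ (b ** d)) t).
Proof.
split=> [b e a a'|a e b b']; apply: tlift_lincomb => c d.
  by rewrite (nmul_bilin.1) ((pure_bilin _ _).1).
by rewrite (nmul_bilin.1) ((pure_bilin _ _).2).
Qed.

Lemma tmul_bilin : bilin tmul.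
Proof.
split=> [t|s]; first exact: tlift_linear (tmul_bilin_outer t).
move=> e t t'; apply: tlift_lincomb => a b.
exact: tlift_linear (tmul_bilin_inner a b) _ _ _.
Qed.

Lemma tmul_pure a b c d : tmul (a ⊗ b) (c ⊗ d) = (a ** c) ⊗ (b ** d).
Proof.
rewrite /tmul tlift_pure; first by rewrite tlift_pure //; exact: tmul_bilin_inner.
exact: tmul_bilin_outer.
Qed.

Lemma tmulA : associative tmul.
Proof.
have [ml mr] := tmul_bilin.
move=> r s t; move: r; apply: eq_linear_tensor => [c x y|c x y|a b].
- by rewrite ml.
- by rewrite !ml.
move: s; apply: eq_linear_tensor => [c x y|c x y|a' b'].
- by rewrite ml mr.
- by rewrite mr ml.
move: t; apply: eq_linear_tensor => [c x y|c x y|a'' b''].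
- by rewrite !mr.
- by rewrite mr.
by rewrite !tmul_pure !nmulA.
Qed.

HB.instance Definition _ := isNUAlgebra.Build K T tmulA tmul_bilin.
End TensorAlgebra.

(* The multiplier algebra M(A): pairs of a left and a right multiplier, with   *)
(* mulLeft m x standing for m x and mulRight m x for x m.                      *)
Section Multiplier.
Variables (K : comPzRingType) (A : nuAlgType K).

Record is_multiplier (l r : A -> A) : Prop := IsMultiplier {
  mult_linl : linear l;
  mult_linr : linear r;
  multl : forall x y, l (x ** y) = l x ** y;
  multr : forall x y, r (x ** y) = x ** r y;
  mult_mid : forall x y, r x ** y = x ** l y
}.

Record multiplier := Multiplier {
  mulLeft : A -> A;
  mulRight : A -> A;
  multiplierP : is_multiplier mulLeft mulRight
}.

HB.instance Definition _ := gen_eqMixin multiplier.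
HB.instance Definition _ := gen_choiceMixin multiplier.

Lemma multiplier_ext m n :
  mulLeft m =1 mulLeft n -> mulRight m =1 mulRight n -> m = n.
Proof.
case: m n => [l r p] [l' r' p'] /= /funext ll /funext rr.
by subst l' r'; rewrite (Prop_irrelevance p p').
Qed.

Lemma mzero_subproof : is_multiplier (fun=> 0) (fun=> 0).
Proof.
split=> [c x y|c x y|x y|x y|x y]; rewrite ?scaler0 ?addr0 //.
- by rewrite (lin0 (nmul_bilin.1 y)).
- by rewrite (lin0 (nmul_bilin.2 x)).
by rewrite (lin0 (nmul_bilin.1 y)) (lin0 (nmul_bilin.2 x)).
Qed.
Definition mzero := Multiplier mzero_subproof.

Lemma mone_subproof : is_multiplier id id.
Proof. by split. Qed.
Definition mone := Multiplier mone_subproof.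

Lemma mlin_subproof c m n : is_multiplier
  (fun x => c *: mulLeft m x + mulLeft n x)
  (fun x => c *: mulRight m x + mulRight n x).
Proof.
case: m n => [l r [a1 a2 a3 a4 a5]] [l' r' [b1 b2 b3 b4 b5]] /=.
have [Bl Br] := @nmul_bilin K A.
split=> [d x y|d x y|x y|x y|x y].
- by rewrite a1 b1 !scalerDr !scalerA mulrC addrACA.
- by rewrite a2 b2 !scalerDr !scalerA mulrC addrACA.
- by rewrite a3 b3 Bl.
- by rewrite a4 b4 Br.
by rewrite Bl Br a5 b5.
Qed.
Definition mlin c m n := Multiplier (mlin_subproof c m n).
Definition madd m n := mlin 1 m n.
Definition mscale c m := mlin c m mzero.
Definition mopp m := mscale (-1) m.

Lemma mmul_subproof m n : is_multiplier
  (mulLeft m \o mulLeft n) (mulRight n \o mulRight m).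
Proof.
case: m n => [l r [a1 a2 a3 a4 a5]] [l' r' [b1 b2 b3 b4 b5]] /=.
split=> [d x y|d x y|x y|x y|x y] /=.
- by rewrite b1 a1.
- by rewrite a2 b2.
- by rewrite b3 a3.
- by rewrite a4 b4.
by rewrite b5 a5.
Qed.
Definition mmul m n := Multiplier (mmul_subproof m n).

Lemma maddA : associative madd.
Proof. by move=> m n p; apply: multiplier_ext => x /=; rewrite !scale1r addrA. Qed.
Lemma maddC : commutative madd.
Proof. by move=> m n; apply: multiplier_ext => x /=; rewrite !scale1r addrC. Qed.
Lemma madd0 : left_id mzero madd.
Proof. by move=> m; apply: multiplier_ext => x /=; rewrite scaler0 add0r. Qed.
Lemma maddN : left_inverse mzero mopp madd.
Proof.
by move=> m; apply: multiplier_ext => x /=;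
  rewrite scale1r addr0 scaleN1r addNr.
Qed.
HB.instance Definition _ := GRing.isZmodule.Build multiplier maddA maddC madd0 maddN.

Lemma mscaleA a b m : mscale a (mscale b m) = mscale (a * b) m.
Proof. by apply: multiplier_ext => x /=; rewrite !addr0 scalerA. Qed.
Lemma mscale1 : left_id 1 mscale.
Proof. by move=> m; apply: multiplier_ext => x /=; rewrite addr0 scale1r. Qed.
Lemma mscaleDr : right_distributive mscale +%R.
Proof.
by move=> c m n; apply: multiplier_ext => x /=;
  rewrite !addr0 !scale1r scalerDr.
Qed.
Lemma mscaleDl m : {morph mscale^~ m : a b / a + b}.
Proof.
by move=> a b; apply: multiplier_ext => x /=; rewrite !addr0 scale1r scalerDl.
Qed.
HB.instance Definition _ :=
  GRing.Zmodule_isLmodule.Build K multiplier mscaleA mscale1 mscaleDr mscaleDl.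

Lemma mmulA : associative mmul.
Proof. by move=> m n p; apply: multiplier_ext. Qed.
Lemma mmul1m : left_id mone mmul.
Proof. by move=> m; apply: multiplier_ext. Qed.
Lemma mmulm1 : right_id mone mmul.
Proof. by move=> m; apply: multiplier_ext. Qed.
Lemma mmulDl : left_distributive mmul +%R.
Proof.
move=> m n p; apply: multiplier_ext => x //=.
by rewrite !scale1r (linD (mult_linr (multiplierP p))).
Qed.
Lemma mmulDr : right_distributive mmul +%R.
Proof.
move=> m n p; apply: multiplier_ext => x //=.
by rewrite !scale1r (linD (mult_linl (multiplierP m))).
Qed.
HB.instance Definition _ := GRing.Zmodule_isPzRing.Build multiplier
  mmulA mmul1m mmulm1 mmulDl mmulDr.

Lemma inM_subproof a : is_multiplier (fun x => a ** x) (fun x => x ** a).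
Proof.
have [Bl Br] := @nmul_bilin K A.
by split=> [c x y|c x y|x y|x y|x y] /=; rewrite ?Bl ?Br ?nmulA.
Qed.
Definition inM a : multiplier := Multiplier (inM_subproof a).
End Multiplier.

Notation "''M' ( A )" := (multiplier A) (at level 8, format "''M' ( A )") : type_scope.

Section TensorMultiplier.
Variables (K : comPzRingType) (A B : nuAlgType K).

Definition tmap (f : A -> A) (g : B -> B) : tensor A B -> tensor A B :=
  tlift (fun a b => f a ⊗ g b).

Lemma tmap_bilin (f : A -> A) (g : B -> B) : linear f -> linear g ->
  bilin (fun (a : A) (b : B) => f a ⊗ g b).
Proof.
move=> fl gl; have [Pl Pr] := @pure_bilin K A B.
by split=> [b c a a'|a c b b']; rewrite (fl, gl) (Pl, Pr).
Qed.

Lemma tensM_subproof (m : 'M(A)) (n : 'M(B)) : is_multiplier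
  (tmap (mulLeft m) (mulLeft n)) (tmap (mulRight m) (mulRight n)).
Proof.
case: m n => [l r [a1 a2 a3 a4 a5]] [l' r' [b1 b2 b3 b4 b5]] /=.
have L := tmap_bilin a1 b1; have R := tmap_bilin a2 b2.
have Ll := tlift_linear L; have Rl := tlift_linear R.
have [Bl Br] := @nmul_bilin K (tensor A B).
have tp a b c d : (a ⊗ b : tensor A B) ** (c ⊗ d) = (a ** c) ⊗ (b ** d).
  exact: tmul_pure.
split=> // x y; rewrite /tmap.
- move: x; apply: eq_linear_tensor => [c x z|c x z|a b].
  + by rewrite Bl Ll.
  + by rewrite Ll Bl.
  move: y; apply: eq_linear_tensor => [c x z|c x z|a' b'].
  + by rewrite Br Ll.
  + by rewrite Br.
  by rewrite tp !tlift_pure // tp a3 b3.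
- move: x; apply: eq_linear_tensor => [c x z|c x z|a b].
  + by rewrite Bl Rl.
  + by rewrite Bl.
  move: y; apply: eq_linear_tensor => [c x z|c x z|a' b'].
  + by rewrite Br Rl.
  + by rewrite Rl Br.
  by rewrite tp !tlift_pure // tp a4 b4.
move: x; apply: eq_linear_tensor => [c x z|c x z|a b].
+ by rewrite Rl Bl.
+ by rewrite Bl.
move: y; apply: eq_linear_tensor => [c x z|c x z|a' b'].
+ by rewrite Br.
+ by rewrite Ll Br.
by rewrite !tlift_pure // !tp a5 b5.
Qed.

Definition tensM (m : 'M(A)) (n : 'M(B)) : 'M(tensor A B) :=
  Multiplier (tensM_subproof m n).
End TensorMultiplier.

(* f ⊗ g for linear maps into multiplier algebras. *)
Definition tensMmap (K : comPzRingType) (A B A' B' : nuAlgType K)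
    (f : A -> 'M(A')) (g : B -> 'M(B')) : tensor A B -> 'M(tensor A' B') :=
  tlift (fun a b => tensM (f a) (g b)).

(* m' is the image of m : M(A) under the extension to M(A) of the              *)
(* non-degenerate homomorphism h : A -> M(B).                                  *)
Definition extends_at (K : comPzRingType) (A B : nuAlgType K)
    (h : A -> 'M(B)) (m : 'M(A)) (m' : 'M(B)) : Prop :=
  forall a, h (mulLeft m a) = m' * h a /\ h (mulRight m a) = h a * m'.

Definition tassoc (K : comPzRingType) (U V W : lmodType K) :
    tensor (tensor U V) W -> tensor U (tensor V W) :=
  tlift (fun t w => tlift (fun u v => u ⊗ (v ⊗ w)) t).

Definition lslice (K : comPzRingType) (U V : lmodType K) (w : U -> K)
  (t : tensor U V) : V := tlift (fun u v => w u *: v) t.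
Definition rslice (K : comPzRingType) (U V : lmodType K) (w : V -> K)
  (t : tensor U V) : U := tlift (fun u v => w v *: u) t.

HB.mixin Record isStar (K : numClosedFieldType) A of NUAlgebra K A := {
  star : A -> A;
  starK : involutive star;
  star_semilinear : forall (c : K) x y, star (c *: x + y) = c^* *: star x + star y;
  starM : forall x y, star (x ** y) = star y ** star x
}.

#[short(type="nuStarAlgType")]
HB.structure Definition NUStarAlgebra (K : numClosedFieldType) :=
  {A of NUAlgebra K A & isStar K A}.

(* The complex conjugate of a vector space, through which conjugate-linear     *)
(* maps are seen as linear ones.                                               *)
Definition conjmod (K : numClosedFieldType) (V : lmodType K) : Type := V.
Section ConjMod.
Variables (K : numClosedFieldType) (V : lmodType K).
HB.instance Definition _ := GRing.Zmodule.on (conjmod V).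
Definition cscale (c : K) (v : conjmod V) : conjmod V := c^* *: (v : V).
Lemma cscaleA a b v : cscale a (cscale b v) = cscale (a * b) v.
Proof. by rewrite /cscale scalerA rmorphM. Qed.
Lemma cscale1 : left_id 1 cscale.
Proof. by move=> v; rewrite /cscale rmorph1 scale1r. Qed.
Lemma cscaleDr : right_distributive cscale +%R.
Proof. by move=> c u v; rewrite /cscale scalerDr. Qed.
Lemma cscaleDl v : {morph cscale^~ v : a b / a + b}.
Proof. by move=> a b; rewrite /cscale rmorphD scalerDl. Qed.
HB.instance Definition _ := GRing.Zmodule_isLmodule.Build K (conjmod V)
  cscaleA cscale1 cscaleDr cscaleDl.
End ConjMod.

Section TensorStar.
Variables (K : numClosedFieldType) (A B : nuStarAlgType K).
Local Notation T := (tensor A B).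

Definition tstar (t : T) : T :=
  (tlift (fun a b => (star a ⊗ star b : conjmod T)) t : conjmod T).

Lemma tstar_bilin : bilin (fun (a : A) (b : B) => (star a ⊗ star b : conjmod T)).
Proof.
have [Pl Pr] := @pure_bilin K A B.
by split=> [b c a a'|a c b b']; rewrite star_semilinear (Pl, Pr).
Qed.

Lemma tstar_semilinear (c : K) s t : tstar (c *: s + t) = c^* *: tstar s + tstar t.
Proof. exact: (tlift_linear tstar_bilin). Qed.

Lemma tstar_pure a b : tstar (a ⊗ b) = star a ⊗ star b.
Proof. by rewrite /tstar tlift_pure //; exact: tstar_bilin. Qed.

Lemma tstarK : involutive tstar.
Proof.
apply: eq_linear_tensor => [c s t|//|a b].
  by rewrite !tstar_semilinear conjCK.
by rewrite !tstar_pure !starK.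
Qed.

Lemma tstarM s t : tstar (s ** t) = tstar t ** tstar s.
Proof.
have [Bl Br] := @nmul_bilin K T.
have tp a b c d : (a ⊗ b : T) ** (c ⊗ d) = (a ** c) ⊗ (b ** d).
  exact: tmul_pure.
move: s; apply: (@eq_linear_tensor _ _ _ (conjmod T)) => [c s s'|c s s'|a b].
- by rewrite Bl tstar_semilinear.
- by rewrite tstar_semilinear Br.
move: t; apply: (@eq_linear_tensor _ _ _ (conjmod T)) => [c s s'|c s s'|a' b'].
- by rewrite Br tstar_semilinear.
- by rewrite tstar_semilinear Bl.
by rewrite tp !tstar_pure tp !starM.
Qed.

HB.instance Definition _ := isStar.Build K T tstarK tstar_semilinear tstarM.
End TensorStar.

Section MultiplierStar.
Variables (K : numClosedFieldType) (A : nuStarAlgType K).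

Lemma Mstar_subproof (m : 'M(A)) : is_multiplier
  (fun x => star (mulRight m (star x))) (fun x => star (mulLeft m (star x))).
Proof.
case: m => [l r [a1 a2 a3 a4 a5]] /=.
split=> [c x y|c x y|x y|x y|x y].
- by rewrite star_semilinear a2 star_semilinear conjCK.
- by rewrite star_semilinear a1 star_semilinear conjCK.
- by rewrite starM a4 starM starK.
- by rewrite starM a3 starM starK.
apply: (can_inj starK).
by rewrite !starM !starK a5.
Qed.
Definition Mstar (m : 'M(A)) : 'M(A) := Multiplier (Mstar_subproof m).
End MultiplierStar.

(* comul x (1 ⊗ y) and (x ⊗ 1) comul y in M(A ⊗ A). *)
Definition coverR (K : comPzRingType) (A : nuAlgType K)
    (D : A -> 'M(tensor A A)) (x y : A) : 'M(tensor A A) :=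
  D x * tensM 1 (inM y).
Definition coverL (K : comPzRingType) (A : nuAlgType K)
    (D : A -> 'M(tensor A A)) (x y : A) : 'M(tensor A A) :=
  tensM (inM x) 1 * D y.

(* (D ⊗ id) D = (id ⊗ D) D, both sides being computed with the extensions of   *)
(* D ⊗ id and id ⊗ D to M(A ⊗ A).                                              *)
Definition coassociative (K : comPzRingType) (A : nuAlgType K)
    (D : A -> 'M(tensor A A)) : Prop :=
  forall a, exists m m',
    [/\ extends_at (tensMmap D (@inM K A)) (D a) m,
        extends_at (tensMmap (@inM K A) D) (D a) m' &
        forall t, tassoc (mulLeft m t) = mulLeft m' (tassoc t) /\
                  tassoc (mulRight m t) = mulRight m' (tassoc t)].

Definition bij_onto_tensor (K : comPzRingType) (A : nuAlgType K)
    (W : tensor A A -> 'M(tensor A A)) : Prop :=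
  [/\ injective W, forall t, exists s, W t = inM s & forall s, exists t, W t = inM s].

HB.mixin Record isMultHopfStar (K : numClosedFieldType) A of NUStarAlgebra K A := {
  mhs_nondegenerate : nondegenerate_product A;
  comul : A -> 'M(tensor A A);
  comul_linear : linear comul;
  comulM : forall x y, comul (x ** y) = comul x * comul y;
  comul_star : forall x, comul (star x) = Mstar (comul x);
  comul_nondegenerate : forall t : tensor A A,
    exists s : seq (A * tensor A A), t = \sum_(p <- s) mulLeft (comul p.1) p.2;
  comul_coassociative : coassociative comul;
  comul_bijR : bij_onto_tensor (tlift (coverR comul));
  comul_bijL : bij_onto_tensor (tlift (coverL comul))
}.

#[short(type="multHopfStarType")]
HB.structure Definition MultHopfStar (K : numClosedFieldType) :=
  {A of NUStarAlgebra K A & isMultHopfStar K A}.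

Section HopfNotions.
Variables (K : numClosedFieldType) (A : multHopfStarType K).

(* As A is non-degenerate, a multiplier is determined by either of its sides.  *)
(* m = (w ⊗ id)(comul x) and m = (id ⊗ w)(comul x), covered by                 *)
(* multiplication: m y = (w ⊗ id)(comul x (1 ⊗ y)) and                         *)
(* y m = (id ⊗ w)((y ⊗ 1) comul x).                                            *)
Definition lleg (w : A -> K) (x : A) (m : 'M(A)) : Prop :=
  forall y, exists2 t, inM t = coverR comul x y & mulLeft m y = lslice w t.
Definition rleg (w : A -> K) (x : A) (m : 'M(A)) : Prop :=
  forall y, exists2 t, inM t = coverL comul y x & mulRight m y = rslice w t.

Definition is_counit (eps : {scalar A}) : Prop :=
  [/\ forall x y, eps (x ** y) = eps x * eps y,
      forall x, eps (star x) = (eps x)^* &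
      forall x, lleg eps x (inM x) /\ rleg eps x (inM x)].

(* The last two clauses are S(x_(1)) x_(2) y = eps(x) y and                    *)
(* x y_(1) S(y_(2)) = eps(y) x.                                                *)
Definition is_antipode (eps : {scalar A}) (S S' : {linear A -> A}) : Prop :=
  [/\ cancel S S' /\ cancel S' S,
      forall x y, S (x ** y) = S y ** S x,
      forall x, star (S (star (S x))) = x,
      forall x y t, inM t = coverR comul x y ->
        tlift (fun u v => S u ** v) t = eps x *: y &
      forall x y t, inM t = coverL comul x y ->
        tlift (fun u v => u ** S v) t = eps y *: x].

Definition nonzero_functional (f : A -> K) : Prop := exists x, f x != 0.

Definition left_integral (f : {scalar A}) : Prop :=
  nonzero_functional f /\ forall x, rleg f x (f x *: (1 : 'M(A))).
Definition right_integral (f : {scalar A}) : Prop :=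
  nonzero_functional f /\ forall x, lleg f x (f x *: (1 : 'M(A))).

Definition positive_functional (f : A -> K) : Prop :=
  forall x, 0 <= f (star x ** x).

End HopfNotions.

(* B, through the pairing, is the space {phi(· a) : a in A} of functionals on   *)
(* A, with product dual to comul, and comul opposite to the dual of the         *)
(* product. S is the antipode of A and SB' the inverse of that of B. The        *)
(* Sweedler legs are covered through the pairing:                               *)
(*   <a_(1), b> a_(2) is in A  and  <a', b_(1)> b_(2) is in B.                  *)
Record is_dual (K : numClosedFieldType) (A B : multHopfStarType K)
    (phi : {scalar A}) (S : A -> A) (SB' : B -> B) (pair : A -> B -> K) : Prop :=
  IsDual {
    dual_linl : forall b, scalar (pair^~ b);
    dual_linr : forall a, scalar (pair a);
    dual_faithful : forall b, (forall a, pair a b = 0) -> b = 0;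
    dual_range : forall f : A -> K,
      (exists b, f = pair^~ b) <-> (exists a, f = fun x => phi (x ** a));
    dual_mul : forall a b, exists2 z, lleg (pair^~ b) a (inM z) &
      forall b', pair a (b ** b') = pair z b';
    dual_comul : forall a' b, exists2 z, lleg (pair a') b (inM z) &
      forall a, pair (a ** a') b = pair a z;
    dual_star : forall a b, pair a (star b) = (pair (star (S a)) b)^*;
    dual_antipode : forall a b, pair (S a) b = pair a (SB' b)
  }.

Section GNS.
Variables (R : realType) (A : multHopfStarType R[i]).
Variable H : completeNormedModType R[i].

(* (H, ip) is a Hilbert space completion of A for the form                      *)
(* (x', x) |-> phi(x^* x'), with canonical imbedding eta.                       *)
Record is_GNS (phi : {scalar A}) (ip : {dot H for Num.conj})
    (eta : {linear A -> H}) : Prop := IsGNS {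
  gns_norm : forall u, ip u u = `|u| ^+ 2;
  gns_form : forall x x', ip (eta x') (eta x) = phi (star x ** x');
  gns_dense : dense (range eta)
}.

Definition bounded_operator (T : H -> H) : Prop :=
  exists M : R[i], forall u, `|T u| <= M * `|u|.

Definition is_mult_operator (eta : A -> H) (a : A) (T : {linear H -> H}) : Prop :=
  bounded_operator T /\ forall x, T (eta x) = eta (a ** x).

(* T eta(x) = w(x_(1)) eta(x_(2)). *)
Definition is_leg_operator (eta : A -> H) (w : A -> R[i])
    (T : {linear H -> H}) : Prop :=
  bounded_operator T /\
  forall x, exists2 z, lleg w x (inM z) & T (eta x) = eta z.

End GNS.

(* Main.v *)
Require Import Defs.
From HB Require Import structures.
From mathcomp Require Import all_boot all_order all_algebra.
From mathcomp Require Import all_classical all_reals all_analysis.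
From mathcomp Require Import complex.

Set Implicit Arguments.
Unset Strict Implicit.
Unset Printing Implicit Defensive.

Import Order.TTheory GRing.Theory Num.Theory numFieldNormedType.Exports.
Local Open Scope ring_scope.

(** On the dense subspaces A and B everything is algebra. The key relation is the
    strong left invariance of phi,
      S((id ⊗ phi)(D(p)(1 ⊗ x))) = (id ⊗ phi)((1 ⊗ p)D(x)),
    obtained by inserting S(p_1)p_2 into the invariance of phi at p x
    (strong_left_invariance). Sliced by a functional b it says that
      phi(p <S^-1(x_1), b> x_2) = <p_1, b> phi(p_2 x),
    that is, F(lambda(b) x) = b F(x): the Fourier transform turns lambda(b) into
    multiplication by b (fourier_leg_mul). That it turns multiplication by a into
    lambda(a) is read off the pairing, since <p, F(a x)> = phi(p a x) =
    <p a, F(x)> (fourier_mul_leg).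

    Since the integral of B at F(z) is eps(z), the first relation with
    b = F(x)^* gives
      phi(F(x)^* F(x')) = <S^-1(x'), F(x)^*> = conj(phi(x'^* x)) = phi(x^* x'),
    so F preserves the scalar products (plancherel; the last step uses that the
    positive functional phi is hermitian, by polarization). As F is onto B, both
    F and its inverse extend by density to isometries of the completions
    (isometric_extension), and two bounded operators that agree on a dense
    subspace are equal (bounded_dense_eq).

    The legs of a coproduct are multipliers, and the identities above are proved
    for coproducts covered by a factor. A covered coproduct is an element of
    A ⊗ A known through its image in M(A ⊗ A); it is well defined because the
    tensor product of two non-degenerate algebras is again non-degenerate in the
    required sense (tensor_left_faithful), which rests on the fact that
    functionals separate the points of a tensor product. *)

(** * Functionals and slices separate the points of a tensor product *)

Section Separation.
Variable K : fieldType.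

(** The kernel of the functional is a subspace W that is maximal among those
    missing x (Zorn): any y outside W then satisfies W + K y = W + K x, so every
    vector is congruent modulo W to exactly one multiple of x. *)
Lemma separating_functional (V : lmodType K) (x : V) :
  x != 0 -> exists f : V -> K, scalar f /\ f x != 0.
Proof.
move=> x0.
pose P (W : set V) := (forall c u v, W u -> W v -> W (c *: u + v)) /\ ~ W x.
(* P leaves out 0 in W, so that the union of the empty chain is covered too. *)
have [W [[Wlin Wx] Wmax]] : exists W, P W /\ forall W', (W `<` W')%classic -> ~ P W'.
  apply: Zorn_bigcup => G GP Gtot; split=> [c u v [X GX Xu] [Y GY Yv]|[X GX Xx]].
    case: (Gtot X Y GX GY) => [XY|YX].
      by exists Y => //; apply: (GP Y GY).1 => //; exact: XY.
    by exists X => //; apply: (GP X GX).1 => //; exact: YX.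
  exact: (GP X GX).2 Xx.
have W0 : W 0.
  apply: contrapT => nW0; apply: (Wmax [set 0]%classic); first split.
  - move=> u Wu; exfalso; apply: nW0.
    by have := Wlin (-1) _ _ Wu Wu; rewrite scaleN1r addNr.
  - by move=> /(_ 0 erefl).
  split=> [c u v -> ->|/eqP]; first by rewrite scaler0 addr0.
  exact/negP.
have WZ c u : W u -> W (c *: u) by move=> Wu; rewrite -[_ *: _]addr0; exact: Wlin.
have WD u v : W u -> W v -> W (u + v).
  by move=> Wu Wv; rewrite -[u]scale1r; exact: Wlin.
have Wc c : W (c *: x) -> c = 0.
  move=> Wcx; apply: contrapT => /eqP c0; apply: Wx.
  by have := WZ c^-1 _ Wcx; rewrite scalerA mulVf ?scale1r.
have ex y : exists c, W (y - c *: x).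
  have [Wy|nWy] := pselect (W y); first by exists 0; rewrite scale0r subr0.
  pose W' : set V := [set u | exists d, W (u - d *: y)]%classic.
  have W'x : W' x.
    apply: contrapT => nx; apply: (Wmax W'); first split.
    - by move=> u Wu; exists 0; rewrite scale0r subr0.
    - move=> /(_ y); apply: (contra_not _ nWy); apply.
      by exists 1; rewrite scale1r subrr.
    split=> // c u v [d Wd] [d' Wd']; exists (c * d + d').
    have -> : c *: u + v - (c * d + d') *: y = c *: (u - d *: y) + (v - d' *: y).
      by rewrite scalerDl scalerBr scalerA opprD addrACA.
    exact: Wlin.
  case: W'x => d Wd.
  have d0 : d != 0 by apply/eqP => d0; apply: Wx; move: Wd; rewrite d0 scale0r subr0.
  exists d^-1; have := WZ (- d^-1) _ Wd.
  by rewrite scalerBr scalerA mulNr mulVf // scaleN1r opprK scaleNr addrC.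
pose f y := sval (cid (ex y)).
have fP y : W (y - f y *: x) by rewrite /f; case: cid.
have fE y c : W (y - c *: x) -> f y = c.
  move=> Wy; apply/eqP; rewrite -subr_eq0; apply/eqP/Wc.
  have := Wlin (-1) _ _ (fP y) Wy.
  by rewrite scaleN1r opprB addrA addrNK scalerBl.
exists f; split=> [c u v|].
  apply: fE.
  have -> : c *: u + v - (c * f u + f v) *: x = c *: (u - f u *: x) + (v - f v *: x).
    by rewrite scalerDl scalerBr scalerA opprD addrACA.
  exact: Wlin.
by rewrite (fE x 1) ?oner_neq0 // scale1r subrr.
Qed.

Lemma vector_separated (V : lmodType K) (x : V) :
  (forall f : V -> K, scalar f -> f x = 0) -> x = 0.
Proof.
move=> h; apply/eqP/negPn/negP => /separating_functional [f [fl]].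
by rewrite h ?eqxx.
Qed.

End Separation.

Section Slices.
Variables (K : comPzRingType) (U V : lmodType K).
Implicit Types t : tensor U V.

Lemma lslice_bilin (w : U -> K) : scalar w -> bilin (fun u (v : V) => w u *: v).
Proof.
move=> wl; split=> [v c u u'|u c v v'].
  by rewrite wl scalerDl scalerA.
by rewrite scalerDr !scalerA mulrC.
Qed.

Lemma rslice_bilin (w : V -> K) : scalar w -> bilin (fun (u : U) v => w v *: u).
Proof.
move=> wl; split=> [v c u u'|u c v v'].
  by rewrite scalerDr !scalerA mulrC.
by rewrite wl scalerDl scalerA.
Qed.

Lemma lslice_linear (w : U -> K) : scalar w -> linear (@lslice K U V w).
Proof. by move=> wl; exact: tlift_linear (lslice_bilin wl). Qed.

Lemma rslice_linear (w : V -> K) : scalar w -> linear (@rslice K U V w).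
Proof. by move=> wl; exact: tlift_linear (rslice_bilin wl). Qed.

Lemma lslice_pure (w : U -> K) u (v : V) : scalar w -> lslice w (u ⊗ v) = w u *: v.
Proof. by move=> wl; rewrite /lslice tlift_pure //; exact: lslice_bilin. Qed.

Lemma rslice_pure (w : V -> K) (u : U) v : scalar w -> rslice w (u ⊗ v) = w v *: u.
Proof. by move=> wl; rewrite /rslice tlift_pure //; exact: rslice_bilin. Qed.

Lemma linear_comp (X Y Z : lmodType K) (f : Y -> Z) (g : X -> Y) :
  linear f -> linear g -> linear (f \o g).
Proof. by move=> fl gl c x y /=; rewrite gl fl. Qed.

Lemma scalar_comp (X Y : lmodType K) (f : Y -> K) (g : X -> Y) :
  scalar f -> linear g -> scalar (f \o g).
Proof. by move=> fl gl c x y /=; rewrite gl fl. Qed.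

(** Both sides are (f ⊗ g) t. *)
Lemma slice_slice (f : U -> K) (g : V -> K) t : scalar f -> scalar g ->
  g (lslice f t) = f (rslice g t).
Proof.
move=> fl gl; move: t.
apply: (eq_linear_tensor (W := K^o)).
- exact: scalar_comp gl (lslice_linear fl).
- exact: scalar_comp fl (rslice_linear gl).
move=> u v /=; rewrite lslice_pure // rslice_pure //.
by rewrite (linZ (V := K^o) gl) (linZ (V := K^o) fl) /GRing.scale /= mulrC.
Qed.

End Slices.

Lemma nmul_pure (K : comPzRingType) (A B : nuAlgType K) (a c : A) (b d : B) :
  (a ⊗ b : tensor A B) ** (c ⊗ d) = (a ** c) ⊗ (b ** d).
Proof. exact: tmul_pure. Qed.

Section Associator.
Variables (K : comPzRingType) (U V W : lmodType K).

Let inner_bilin (w : W) : bilin (fun (u : U) (v : V) => u ⊗ (v ⊗ w)).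
Proof.
have [Pl Pr] := @pure_bilin K U (tensor V W).
have [Ql Qr] := @pure_bilin K V W.
by split=> [v c u u'|u c v v']; rewrite ?Ql (Pl, Pr).
Qed.

Let outer_bilin :
  bilin (fun (t : tensor U V) (w : W) => tlift (fun u v => u ⊗ (v ⊗ w)) t).
Proof.
have [Pl Pr] := @pure_bilin K U (tensor V W).
have [Ql Qr] := @pure_bilin K V W.
split=> [w|t c w w']; first exact: tlift_linear.
by apply: tlift_lincomb => u v; rewrite Qr Pr.
Qed.

Lemma tassoc_linear : linear (@tassoc K U V W).
Proof. exact: tlift_linear outer_bilin. Qed.

Lemma tassoc_pure u v w : tassoc ((u ⊗ v) ⊗ w) = u ⊗ (v ⊗ w) :> tensor U (tensor V W).
Proof. by rewrite /tassoc tlift_pure // tlift_pure. Qed.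

End Associator.

Section TensorSeparation.
Variable K : fieldType.

(** Induction on the length of an expression of t as a sum of pure tensors: if u
    is the first left factor and f u != 0, the vanishing of the slice of t by f
    expresses the right factor of u through the other right factors, so that t is
    a shorter sum. *)
Lemma tensor_separated (U V : lmodType K) (t : tensor U V) :
  (forall f : U -> K, scalar f -> lslice f t = 0) -> t = 0.
Proof.
have [Pl Pr] := @pure_bilin K U V.
rewrite (tensorE t); move: (repr t) => s.
move e : (size s) => n; elim: n s e => [|n IH] [|[u v] s] //= e.
  by rewrite big_nil.
case: e => e; rewrite big_cons /=.
have [->|u0] := eqVneq u 0.
  by rewrite (lin0 (Pl v)) add0r; exact: IH.
case: (separating_functional u0) => f [fl fu] h.
have vE : v = \sum_(p <- s) (- (f u)^-1 * f p.1) *: p.2.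
  have := h f fl; rewrite (linD (lslice_linear fl)) lslice_pure //.
  rewrite (lin_sum (lslice_linear fl)) => /eqP; rewrite addr_eq0 => /eqP h1.
  rewrite -[LHS](scalerK fu) h1 scalerN -scaleNr scaler_sumr.
  by apply: eq_bigr => p _; rewrite lslice_pure // scalerA.
pose s' := [seq (p.1 - ((f u)^-1 * f p.1) *: u, p.2) | p <- s].
have E : u ⊗ v + \sum_(p <- s) pure p.1 p.2 = \sum_(p <- s') pure p.1 p.2.
  rewrite big_map /= vE (lin_sum (Pr u)) -big_split /=.
  apply: eq_bigr => p _.
  by rewrite /= addrC mulNr -scaleNr (linD (Pl _)) (linZ (Pl _)) (linZ (Pr _)).
rewrite E; apply: IH; first by rewrite size_map.
by move=> g gl; rewrite -E; exact: h.
Qed.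

(** The half of non-degeneracy by which an element of A is determined by the left
    multiplication with it, so that A embeds in M(A). *)
Definition left_faithful (A : nuAlgType K) :=
  forall x : A, (forall y, x ** y = 0) -> x = 0.

(** Slicing t (c ⊗ d) on the left gives a slice of t times d, so left slices of
    t by functionals f( . c) vanish; by slice_slice every right slice of t is then
    killed by all c. *)
Lemma tensor_left_faithful (A B : nuAlgType K) :
  left_faithful A -> left_faithful B -> left_faithful (tensor A B).
Proof.
move=> fA fB t ht.
have [Bl Br] := @nmul_bilin K (tensor A B).
have [Al Ar] := @nmul_bilin K A.
have [Bl' Br'] := @nmul_bilin K B.
have lsl f c d (s : tensor A B) : scalar f ->
    lslice f (s ** (c ⊗ d)) = lslice (fun u => f (u ** c)) s ** d.
  move=> fl; have fcl := scalar_comp fl (Al c).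
  move: s; apply: eq_linear_tensor.
  - exact: linear_comp (lslice_linear fl) (Bl _).
  - exact: linear_comp (Bl' d) (lslice_linear fcl).
  move=> a b; rewrite nmul_pure !lslice_pure //.
  by rewrite (linZ (Bl' d)).
have h1 f c : scalar f -> lslice (fun u => f (u ** c)) t = 0.
  by move=> fl; apply: fB => d; rewrite -lsl // ht (lin0 (lslice_linear fl)).
apply: tensor_separated => f fl; apply: vector_separated => g gl.
have gt : rslice g t = 0.
  apply: fA => c; apply: vector_separated => k kl.
  rewrite -(slice_slice _ (f := fun u => k (u ** c))) //.
    by rewrite h1 // (lin0 (V := K^o) gl).
  exact: scalar_comp kl (Al c).
by rewrite slice_slice // gt (lin0 (V := K^o) fl).
Qed.

End TensorSeparation.

(** * Calculus of multipliers of a tensor product *)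

Section MultiplierCalculus.
Variables (K : comPzRingType) (A : nuAlgType K).
Implicit Types (m n : 'M(A)) (x y : A).

Lemma mulLeftM m n x : mulLeft (m * n) x = mulLeft m (mulLeft n x).
Proof. by []. Qed.

Lemma mulRightM m n x : mulRight (m * n) x = mulRight n (mulRight m x).
Proof. by []. Qed.

Lemma multiplier_scaleE (c : K) m :
  (mulLeft (c *: m) =1 fun x => c *: mulLeft m x) *
  (mulRight (c *: m) =1 fun x => c *: mulRight m x).
Proof. by split=> x /=; rewrite addr0. Qed.

Lemma multiplier_addE m n :
  (mulLeft (m + n) =1 fun x => mulLeft m x + mulLeft n x) *
  (mulRight (m + n) =1 fun x => mulRight m x + mulRight n x).
Proof. by split=> x /=; rewrite scale1r. Qed.

Lemma inM_linear : linear (@inM K A).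
Proof.
have [Al Ar] := @nmul_bilin K A.
move=> c x y; apply: multiplier_ext => z;
  by rewrite multiplier_addE multiplier_scaleE /= (Al, Ar).
Qed.

Lemma mulm_linl n : linear (fun m => m * n).
Proof.
move=> c m p; apply: multiplier_ext => z;
  rewrite !(multiplier_addE, multiplier_scaleE, mulLeftM, mulRightM) //.
exact: mult_linr (multiplierP n) _ _ _.
Qed.

Lemma mulm_linr m : linear (fun n => m * n).
Proof.
move=> c n p; apply: multiplier_ext => z;
  rewrite !(multiplier_addE, multiplier_scaleE, mulLeftM, mulRightM) //.
exact: mult_linl (multiplierP m) _ _ _.
Qed.

(** A is an ideal of M(A); with inM_inj this turns identities between elements
    of A into computations in the ring M(A). *)
Lemma mul_inM m x : m * inM x = inM (mulLeft m x).
Proof.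
apply: multiplier_ext => z /=; first exact: multl (multiplierP m) _ _.
exact: mult_mid (multiplierP m) _ _.
Qed.

Lemma inM_mul m x : inM x * m = inM (mulRight m x).
Proof.
apply: multiplier_ext => z /=; last exact: multr (multiplierP m) _ _.
by rewrite (mult_mid (multiplierP m)).
Qed.

Lemma mulLeft_linear m : linear (mulLeft m).
Proof. exact: mult_linl (multiplierP m). Qed.

Lemma mulRight_linear m : linear (mulRight m).
Proof. exact: mult_linr (multiplierP m). Qed.

End MultiplierCalculus.

Lemma inM_inj (K : fieldType) (A : nuAlgType K) :
  left_faithful A -> injective (@inM K A).
Proof.
move=> fA x y e; apply/eqP; rewrite -subr_eq0; apply/eqP; apply: fA => z.
have := congr1 (fun m => mulLeft m z) e => /= e'.
have [Al _] := @nmul_bilin K A.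
by rewrite -scaleN1r addrC Al e' scaleN1r addNr.
Qed.

Section TensorMultiplierCalculus.
Variables (K : comPzRingType) (A B : nuAlgType K).
Implicit Types (m p : 'M(A)) (n q : 'M(B)).

Lemma tensM_pure m n a b :
  (mulLeft (tensM m n) (a ⊗ b) = mulLeft m a ⊗ mulLeft n b) *
  (mulRight (tensM m n) (a ⊗ b) = mulRight m a ⊗ mulRight n b).
Proof.
have ll := @mulLeft_linear; have lr := @mulRight_linear.
by split; rewrite /= /tmap tlift_pure //; apply: tmap_bilin.
Qed.

Lemma tensor_multiplier_ext (x y : 'M(tensor A B)) :
  (forall a b, mulLeft x (a ⊗ b) = mulLeft y (a ⊗ b)) ->
  (forall a b, mulRight x (a ⊗ b) = mulRight y (a ⊗ b)) -> x = y.
Proof.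
move=> hl hr; apply: multiplier_ext; apply: eq_linear_tensor => //;
  by [exact: mulLeft_linear | exact: mulRight_linear].
Qed.

Lemma tensM_bilin : bilin (@tensM K A B).
Proof.
have [Pl Pr] := @pure_bilin K A B.
split=> [n c m m'|m c n n']; apply: tensor_multiplier_ext => a b;
  by rewrite !(multiplier_addE, multiplier_scaleE, tensM_pure) (Pl, Pr).
Qed.

Lemma tensM_mul m p n q : tensM m n * tensM p q = tensM (m * p) (n * q).
Proof.
by apply: tensor_multiplier_ext => a b;
  rewrite !(mulLeftM, mulRightM, tensM_pure).
Qed.

Lemma tensM_inM a b : tensM (inM a) (inM b) = inM (a ⊗ b : tensor A B).
Proof.
by apply: tensor_multiplier_ext => c d; rewrite !tensM_pure /= nmul_pure.
Qed.

(** Slicing commutes with a multiplier of the leg that is kept; one of the leg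
    that is sliced away is absorbed by the functional. *)
Section SliceMultiplier.
Variables (m : 'M(A)) (n : 'M(B)) (f : A -> K) (g : B -> K).
Hypotheses (fl : scalar f) (gl : scalar g).
Implicit Type t : tensor A B.

Lemma rslice_mulLeft t :
  rslice g (mulLeft (tensM m n) t) = mulLeft m (rslice (fun b => g (mulLeft n b)) t).
Proof.
have gnl := scalar_comp gl (mulLeft_linear n).
move: t; apply: eq_linear_tensor.
- exact: linear_comp (rslice_linear gl) (mulLeft_linear _).
- exact: linear_comp (mulLeft_linear _) (rslice_linear gnl).
by move=> a b; rewrite tensM_pure !rslice_pure // (linZ (mulLeft_linear m)).
Qed.

Lemma rslice_mulRight t :
  rslice g (mulRight (tensM m n) t) = mulRight m (rslice (fun b => g (mulRight n b)) t).
Proof.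
have gnl := scalar_comp gl (mulRight_linear n).
move: t; apply: eq_linear_tensor.
- exact: linear_comp (rslice_linear gl) (mulRight_linear _).
- exact: linear_comp (mulRight_linear _) (rslice_linear gnl).
by move=> a b; rewrite tensM_pure !rslice_pure // (linZ (mulRight_linear m)).
Qed.

Lemma lslice_mulLeft t :
  lslice f (mulLeft (tensM m n) t) = mulLeft n (lslice (fun a => f (mulLeft m a)) t).
Proof.
have fml := scalar_comp fl (mulLeft_linear m).
move: t; apply: eq_linear_tensor.
- exact: linear_comp (lslice_linear fl) (mulLeft_linear _).
- exact: linear_comp (mulLeft_linear _) (lslice_linear fml).
by move=> a b; rewrite tensM_pure !lslice_pure // (linZ (mulLeft_linear n)).
Qed.

Lemma lslice_mulRight t :
  lslice f (mulRight (tensM m n) t) = mulRight n (lslice (fun a => f (mulRight m a)) t).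
Proof.
have fml := scalar_comp fl (mulRight_linear m).
move: t; apply: eq_linear_tensor.
- exact: linear_comp (lslice_linear fl) (mulRight_linear _).
- exact: linear_comp (mulRight_linear _) (lslice_linear fml).
by move=> a b; rewrite tensM_pure !lslice_pure // (linZ (mulRight_linear n)).
Qed.

End SliceMultiplier.
End TensorMultiplierCalculus.

Section TensMmap.
Variables (K : comPzRingType) (A B A' B' : nuAlgType K).
Variables (f : A -> 'M(A')) (g : B -> 'M(B')).
Hypotheses (fl : linear f) (gl : linear g).

Lemma tensMmap_bilin : bilin (fun a b => tensM (f a) (g b)).
Proof.
have [Tl Tr] := @tensM_bilin K A' B'.
by split=> [b c a a'|a c b b']; rewrite (fl, gl) (Tl, Tr).
Qed.

Lemma tensMmap_linear : linear (tensMmap f g).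
Proof. exact: tlift_linear tensMmap_bilin. Qed.

Lemma tensMmap_pure a b : tensMmap f g (a ⊗ b) = tensM (f a) (g b).
Proof. by rewrite /tensMmap tlift_pure //; exact: tensMmap_bilin. Qed.

End TensMmap.

Section MstarCalculus.
Variable K : numClosedFieldType.

Lemma MstarM (A : nuStarAlgType K) (m n : 'M(A)) : Mstar (m * n) = Mstar n * Mstar m.
Proof. by apply: multiplier_ext => x /=; rewrite starK. Qed.

Lemma Mstar_inM (A : nuStarAlgType K) (x : A) : Mstar (inM x) = inM (star x).
Proof. by apply: multiplier_ext => y /=; rewrite starM starK. Qed.

Lemma Mstar1 (A : nuStarAlgType K) : Mstar (1 : 'M(A)) = 1.
Proof. by apply: multiplier_ext => y /=; rewrite starK. Qed.

Lemma star_pure (A B : nuStarAlgType K) (a : A) (b : B) :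
  star (a ⊗ b : tensor A B) = star a ⊗ star b.
Proof. exact: tstar_pure. Qed.

Lemma MstarE (A : nuStarAlgType K) (m : 'M(A)) :
  (mulLeft (Mstar m) =1 fun x => star (mulRight m (star x))) *
  (mulRight (Mstar m) =1 fun x => star (mulLeft m (star x))).
Proof. by split. Qed.

Lemma Mstar_tensM (A B : nuStarAlgType K) (m : 'M(A)) (n : 'M(B)) :
  Mstar (tensM m n) = tensM (Mstar m) (Mstar n).
Proof.
apply: tensor_multiplier_ext => a b;
  by rewrite !(MstarE, star_pure, tensM_pure).
Qed.

End MstarCalculus.

(** * Covered coproducts and coassociativity *)

Section CoveredComultiplication.
Variables (K : numClosedFieldType) (A : multHopfStarType K).
Local Notation T := (tensor A A).
Local Notation D := (@comul K A).

Lemma hopf_left_faithful : left_faithful A.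
Proof. exact: (@mhs_nondegenerate K A).1. Qed.

Lemma hopf2_left_faithful : left_faithful T.
Proof. by apply: tensor_left_faithful; exact: hopf_left_faithful. Qed.

Lemma inM2_inj : injective (@inM K T).
Proof. exact/inM_inj/hopf2_left_faithful. Qed.

(** The element of A ⊗ A that a multiplier comes from; 0 is a junk value for the
    multipliers that are not of this form. *)
Definition unM (m : 'M(T)) : T := xget 0 [set t | inM t = m]%classic.

Lemma unMK m : (exists t, inM t = m) -> inM (unM m) = m.
Proof. by case=> t tm; rewrite /unM; case: xgetP => [x -> //|/(_ t)]. Qed.

(** The coproduct covered on one leg, as an element of A ⊗ A: the letter tells
    from which side it is multiplied, the digit on which leg. *)
Definition comul_r2 x y := unM (D x * tensM 1 (inM y)).
Definition comul_l1 x y := unM (tensM (inM x) 1 * D y).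
Definition comul_r1 x y := unM (D x * tensM (inM y) 1).
Definition comul_l2 x y := unM (tensM 1 (inM x) * D y).

Lemma inM_comul_r2 x y : inM (comul_r2 x y) = D x * tensM 1 (inM y).
Proof.
apply: unMK; have [_ /(_ (x ⊗ y)) [t tE] _] := @comul_bijR K A.
exists t; rewrite -tE tlift_pure //.
have [Tl Tr] := @tensM_bilin K A A.
split=> [b c a a'|a c b b']; rewrite /coverR.
  by rewrite comul_linear mulm_linl.
by rewrite inM_linear Tr mulm_linr.
Qed.

Lemma inM_comul_l1 x y : inM (comul_l1 x y) = tensM (inM x) 1 * D y.
Proof.
apply: unMK; have [_ /(_ (x ⊗ y)) [t tE] _] := @comul_bijL K A.
exists t; rewrite -tE tlift_pure //.
have [Tl Tr] := @tensM_bilin K A A.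
split=> [b c a a'|a c b b']; rewrite /coverL.
  by rewrite inM_linear Tl mulm_linl.
by rewrite comul_linear mulm_linr.
Qed.

(** This covering and the next one are not among the axioms: they are the images
    of the two axiomatic ones under the involution. *)
Lemma inM_comul_r1 x y : inM (comul_r1 x y) = D x * tensM (inM y) 1.
Proof.
apply: unMK; exists (star (comul_l1 (star y) (star x))).
rewrite -Mstar_inM inM_comul_l1 MstarM Mstar_tensM Mstar1 Mstar_inM.
by rewrite -comul_star !starK.
Qed.

Lemma inM_comul_l2 x y : inM (comul_l2 x y) = tensM 1 (inM x) * D y.
Proof.
apply: unMK; exists (star (comul_r2 (star y) (star x))).
rewrite -Mstar_inM inM_comul_r2 MstarM Mstar_tensM Mstar1 Mstar_inM.
by rewrite -comul_star !starK.
Qed.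

Lemma comul_r1_linear y : linear (comul_r1^~ y).
Proof.
move=> c x x'; apply: inM2_inj.
by rewrite inM_linear !inM_comul_r1 comul_linear mulm_linl.
Qed.

(** As 1 ⊗ v and c ⊗ 1 commute, a pure tensor may be applied one leg at a time. *)
Lemma comul_pure p c v :
  mulLeft (D p) (c ⊗ v) = mulRight (tensM (inM c) 1) (comul_r2 p v).
Proof.
apply: inM2_inj; rewrite -mul_inM -inM_mul inM_comul_r2 -tensM_inM.
by rewrite -mulrA tensM_mul mul1r mulr1.
Qed.

Lemma comul_leg_bilin (q : T) : bilin (fun (u : A) (w : A) => mulLeft (D u) q ⊗ w).
Proof.
have [Pl Pr] := @pure_bilin K T A.
split=> [w c u u'|u c w w']; last by rewrite Pr.
by rewrite comul_linear multiplier_addE multiplier_scaleE Pl.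
Qed.

Lemma comul_r1_leg_bilin e y : bilin (fun (u : A) (w : A) => (u ** e) ⊗ comul_r1 w y).
Proof.
have [Pl Pr] := @pure_bilin K A T; have [Al Ar] := @nmul_bilin K A.
by split=> [w c u u'|u c w w']; rewrite (Al, comul_r1_linear) (Pl, Pr).
Qed.

(** The extension m of D ⊗ id at D(p) is computed on pure tensors q ⊗ v. Its
    definition gives the value on D(c) q ⊗ v, and by non-degeneracy of D the
    elements D(c) q span A ⊗ A. *)
Lemma extension_left p m :
  extends_at (tensMmap D (@inM K A)) (D p) m -> forall q v,
  mulLeft m (q ⊗ v) = tlift (fun u w => mulLeft (D u) q ⊗ w) (comul_r2 p v).
Proof.
move=> mE q v.
have [Pl Pr] := @pure_bilin K T A.
have injTA : injective (@inM K (tensor T A)).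
  apply/inM_inj/tensor_left_faithful; first exact: hopf2_left_faithful.
  exact: hopf_left_faithful.
have TDl := tensMmap_linear (@comul_linear K A) (@inM_linear K A).
have TDp := tensMmap_pure (@comul_linear K A) (@inM_linear K A).
have covered c q0 t :
    tensMmap D (@inM K A) (mulRight (tensM (inM c) 1) t) * tensM (inM q0) 1 =
    inM (tlift (fun u w => mulLeft (D u) (mulLeft (D c) q0) ⊗ w) t).
  move: t; apply: eq_linear_tensor.
  - apply: linear_comp (mulm_linl _) _.
    exact: linear_comp TDl (mulRight_linear _).
  - apply: linear_comp (@inM_linear _ _) _.
    exact: tlift_linear (comul_leg_bilin _).
  move=> u w; rewrite tensM_pure /= TDp tlift_pure; last exact: comul_leg_bilin.
  by rewrite tensM_mul mulr1 comulM -mulrA !mul_inM tensM_inM.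
have step c q0 : mulLeft m (mulLeft (D c) q0 ⊗ v) =
    tlift (fun u w => mulLeft (D u) (mulLeft (D c) q0) ⊗ w) (comul_r2 p v).
  apply: injTA; rewrite -covered -comul_pure (mE _).1 TDp -mul_inM.
  by rewrite -mulrA tensM_mul mulr1 (mul_inM (D c)) tensM_inM.
have [s ->] := comul_nondegenerate q.
have Ll : linear (fun q => mulLeft m (q ⊗ v)).
  exact: linear_comp (mulLeft_linear _) (Pl v).
have Rl : linear (fun q => tlift (fun u w => mulLeft (D u) q ⊗ w) (comul_r2 p v)).
  move=> c q1 q2; apply: tlift_lincomb => u w.
  by rewrite (mulLeft_linear (D u)) Pl.
rewrite (lin_sum Ll) (lin_sum Rl).
by apply: eq_bigr => i _; exact: step.
Qed.

(** On this side the covering D(x)(y ⊗ 1) is needed below, so the value is taken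
    on these elements directly. *)
Lemma extension_right p m :
  extends_at (tensMmap (@inM K A) D) (D p) m -> forall e x y,
  mulLeft m (e ⊗ comul_r1 x y) = tlift (fun u w => (u ** e) ⊗ comul_r1 w y) (comul_r2 p x).
Proof.
move=> mE e x y.
have injAT : injective (@inM K (tensor A T)).
  apply/inM_inj/tensor_left_faithful; first exact: hopf_left_faithful.
  exact: hopf2_left_faithful.
have TDl := tensMmap_linear (@inM_linear K A) (@comul_linear K A).
have TDp := tensMmap_pure (@inM_linear K A) (@comul_linear K A).
have covered t :
    tensMmap (@inM K A) D (mulRight (tensM (inM e) 1) t) * tensM 1 (tensM (inM y) 1) =
    inM (tlift (fun u w => (u ** e) ⊗ comul_r1 w y) t).
  move: t; apply: eq_linear_tensor.
  - apply: linear_comp (mulm_linl _) _.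
    exact: linear_comp TDl (mulRight_linear _).
  - apply: linear_comp (@inM_linear _ _) _.
    exact: tlift_linear (comul_r1_leg_bilin _ _).
  move=> u w; rewrite tensM_pure /= TDp tlift_pure; last exact: comul_r1_leg_bilin.
  by rewrite tensM_mul mulr1 -inM_comul_r1 tensM_inM.
apply: injAT; rewrite -covered -comul_pure (mE _).1 TDp -mul_inM.
by rewrite -mulrA tensM_mul mulr1 -inM_comul_r1 tensM_inM.
Qed.

(** (D ⊗ id)D(p) = (id ⊗ D)D(p), both sides applied to e ⊗ D(x)(y ⊗ 1). With
    D(x)(y ⊗ 1) = sum u ⊗ v, the left side is the sum of
    D(p_1)(e ⊗ u) ⊗ p_2 v, the right side is p_1 e ⊗ D(p_2 x)(y ⊗ 1). *)
Lemma covered_coassociativity p e x y :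
  tlift (fun u v =>
      tassoc (tlift (fun a w => mulLeft (D a) (e ⊗ u) ⊗ w) (comul_r2 p v))) (comul_r1 x y)
  = tlift (fun a w => (a ** e) ⊗ comul_r1 w y) (comul_r2 p x).
Proof.
have [m [m' [mE mE' mm']]] := @comul_coassociative K A p.
have [Pl Pr] := @pure_bilin K A T.
rewrite -(extension_right mE'); set r := comul_r1 x y.
rewrite [in RHS](tensorE r) (lin_sum (Pr e)) (lin_sum (mulLeft_linear _)).
rewrite {1}/tlift /formal_eval; apply: eq_bigr => -[u v] _ /=.
rewrite -(extension_left mE) (mm' _).1; congr mulLeft.
by rewrite tassoc_pure.
Qed.

End CoveredComultiplication.

(** * Antipode, counit and strong left invariance *)

Section Integrals.
Variables (K : numClosedFieldType) (A : multHopfStarType K).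
Variables (eps : {scalar A}) (S S' : {linear A -> A}).
Hypotheses (eps_counit : is_counit eps) (S_antipode : is_antipode eps S S').
Local Notation T := (tensor A A).
Local Notation D := (@comul K A).

Implicit Types x y z : A.

Let Sl : linear S. Proof. by move=> c x y; rewrite linearP. Qed.

Lemma nmul_cancel_l (x y : A) : (forall c, c ** x = c ** y) -> x = y.
Proof.
move=> h; apply/eqP; rewrite -subr_eq0; apply/eqP.
apply: (@mhs_nondegenerate K A).2 => c.
have [_ Ar] := @nmul_bilin K A.
by rewrite -scaleN1r addrC Ar h scaleN1r addNr.
Qed.

Lemma nmul_cancel_r (x y : A) : (forall c, x ** c = y ** c) -> x = y.
Proof.
move=> h; apply/eqP; rewrite -subr_eq0; apply/eqP.
apply: (@mhs_nondegenerate K A).1 => c.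
have [Al _] := @nmul_bilin K A.
by rewrite -scaleN1r addrC Al h scaleN1r addNr.
Qed.

Lemma llegE (w : A -> K) x z y :
  scalar w -> lleg w x (inM z) -> z ** y = lslice w (comul_r2 x y).
Proof.
move=> wl /(_ y) [t tE /= ->]; congr lslice; apply: inM2_inj.
by rewrite inM_comul_r2 tE.
Qed.

Lemma lleg_unique (w : A -> K) x z z' : scalar w ->
  lleg w x (inM z) -> lleg w x (inM z') -> z = z'.
Proof.
move=> wl h h'; apply: nmul_cancel_r => y.
by rewrite (llegE y wl h) (llegE y wl h').
Qed.

Lemma rlegE (w : A -> K) x (m : 'M(A)) y :
  rleg w x m -> mulRight m y = rslice w (comul_l1 y x).
Proof.
move=> /(_ y) [t tE ->]; congr rslice; apply: inM2_inj.
by rewrite inM_comul_l1 tE.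
Qed.

Let epsl : scalar eps. Proof. by move=> c x y; rewrite linearP. Qed.

Lemma lslice_counit x y : lslice eps (comul_r2 x y) = x ** y.
Proof. by have [_ _ /(_ x) [h _]] := eps_counit; rewrite -(llegE y epsl h). Qed.

Lemma rslice_counit x y : rslice eps (comul_l1 x y) = x ** y.
Proof. by have [_ _ /(_ y) [_ h]] := eps_counit; rewrite -(rlegE _ h). Qed.

(** m (S ⊗ id), where m is the product. *)
Definition antimul (t : T) : A := tlift (fun u v => S u ** v) t.

Lemma antimul_bilin : bilin (fun u v : A => S u ** v).
Proof.
have [Al Ar] := @nmul_bilin K A.
by split=> [v c u u'|u c v v']; rewrite ?Sl (Al, Ar).
Qed.

Lemma antimul_linear : linear antimul.
Proof. exact: tlift_linear antimul_bilin. Qed.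

Lemma antimul_comul_r2 x y : antimul (comul_r2 x y) = eps x *: y.
Proof. by have [_ _ _ h _] := S_antipode; apply: h; rewrite inM_comul_r2. Qed.

Lemma antimul_mulRight e t : antimul (mulRight (tensM (inM e) 1) t) = S e ** antimul t.
Proof.
have [Al Ar] := @nmul_bilin K A.
move: t; apply: eq_linear_tensor.
- exact: linear_comp antimul_linear (mulRight_linear _).
- exact: linear_comp (Ar (S e)) antimul_linear.
move=> u v; rewrite tensM_pure /antimul !tlift_pure; try exact: antimul_bilin.
by have [_ SM _ _ _] := S_antipode; rewrite /= SM nmulA.
Qed.

Lemma S_surj x : exists y, x = S y.
Proof. by have [[_ c] _ _ _ _] := S_antipode; exists (S' x); rewrite c. Qed.

Variable phi : {scalar A}.
Hypothesis phi_left : left_integral phi.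
Let phil : scalar phi. Proof. by move=> c x y; rewrite linearP. Qed.

(** The integral is invariant for left coverings by definition; associativity
    moves a left covering of D(x) to a right one. *)
Lemma left_invariance x y : rslice phi (comul_r1 x y) = phi x *: y.
Proof.
have [Al Ar] := @nmul_bilin K A.
apply: nmul_cancel_l => c.
have -> : c ** rslice phi (comul_r1 x y) =
    rslice phi (mulLeft (tensM (inM c) 1) (comul_r1 x y)) by rewrite rslice_mulLeft.
have -> : mulLeft (tensM (inM c) 1) (comul_r1 x y) =
    mulRight (tensM (inM y) 1) (comul_l1 c x).
  by apply: inM2_inj; rewrite -mul_inM -inM_mul inM_comul_r1 inM_comul_l1 mulrA.
rewrite rslice_mulRight //=.
have [_ /(_ x) h] := phi_left.
rewrite -(rlegE c h) multiplier_scaleE /=.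
by rewrite (linZ (Al y)) (linZ (Ar c)).
Qed.

(** By invariance at p_2 x,
      S(p_1) phi(p_2 x) y = S(p_1) p_2 x_1 y phi(p_3 x_2),
    and the antipode property leaves x_1 y phi(p x_2) on the right. This is
    covered_coassociativity under the map u ⊗ s |-> S(u) (id ⊗ phi)(s); the
    covering element e only adds a factor S(e) on the left, which is arbitrary as
    S is onto. *)
Lemma strong_left_invariance p x y :
  rslice (fun v => phi (p ** v)) (comul_r1 x y) = S (rslice phi (comul_r2 p x)) ** y.
Proof.
have [Al Ar] := @nmul_bilin K A.
apply: nmul_cancel_l => c; have [e {c}->] := S_surj c.
pose Phi := tlift (fun (u : A) (s : T) => S u ** rslice phi s).
have Phi_bilin : bilin (fun (u : A) (s : T) => S u ** rslice phi s).
  by split=> [s k u u'|u k s s']; rewrite ?Sl ?(rslice_linear phil) (Al, Ar).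
have Phil : linear Phi := tlift_linear Phi_bilin.
have Phi_tassoc q w : Phi (tassoc (q ⊗ w)) = phi w *: antimul q.
  move: q; apply: eq_linear_tensor.
  - apply: linear_comp Phil _; apply: linear_comp (@tassoc_linear _ _ _ _) _.
    exact: (@pure_bilin K T A).1 w.
  - move=> k q q'; rewrite antimul_linear scalerDr !scalerA.
    by rewrite [phi w * k]mulrC.
  move=> u v; rewrite tassoc_pure /Phi /antimul !tlift_pure //.
    by rewrite rslice_pure // (linZ (Ar _)).
  exact: antimul_bilin.
have left_side u t :
    Phi (tassoc (tlift (fun a w => mulLeft (D a) (e ⊗ u) ⊗ w) t)) =
    phi (lslice eps t) *: (S e ** u).
  move: t; apply: eq_linear_tensor.
  - apply: linear_comp Phil _; apply: linear_comp (@tassoc_linear _ _ _ _) _.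
    exact: tlift_linear (comul_leg_bilin _).
  - move=> k t t'; rewrite (lslice_linear epsl) phil.
    by rewrite scalerDl scalerA.
  move=> a w; rewrite tlift_pure; last exact: comul_leg_bilin.
  rewrite Phi_tassoc comul_pure antimul_mulRight antimul_comul_r2 lslice_pure //.
  by rewrite (linZ (Ar _)) (linZ (V := K^o) phil) scalerA mulrC.
have right_side t : Phi (tlift (fun a w => (a ** e) ⊗ comul_r1 w y) t) =
    S e ** (S (rslice phi t) ** y).
  move: t; apply: eq_linear_tensor.
  - exact: linear_comp Phil (tlift_linear (comul_r1_leg_bilin _ _)).
  - by move=> k t t'; rewrite (rslice_linear phil) Sl Al Ar.
  move=> a w; rewrite tlift_pure; last exact: comul_r1_leg_bilin.
  rewrite /Phi tlift_pure // left_invariance rslice_pure // (linZ Sl).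
  have [_ SM _ _ _] := S_antipode.
  by rewrite SM (linZ (Al y)) !(linZ (Ar _)) nmulA.
rewrite -right_side -covered_coassociativity.
rewrite {2}/tlift /formal_eval (lin_sum Phil).
rewrite /rslice {1}/tlift /formal_eval (lin_sum (Ar _)).
apply: eq_bigr => -[u v] _ /=.
by rewrite left_side lslice_counit (linZ (Ar _)).
Qed.

(** With D(x) covered by 1 ⊗ p, the factor y of the previous identity cancels by
    non-degeneracy. *)
Lemma strong_left_invariance_slices p x :
  rslice phi (comul_l2 p x) = S (rslice phi (comul_r2 p x)).
Proof.
apply: nmul_cancel_r => y; rewrite -strong_left_invariance.
have -> : rslice phi (comul_l2 p x) ** y =
    rslice phi (mulRight (tensM (inM y) 1) (comul_l2 p x)) by rewrite rslice_mulRight.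
have -> : mulRight (tensM (inM y) 1) (comul_l2 p x) =
    mulLeft (tensM 1 (inM p)) (comul_r1 x y).
  by apply: inM2_inj; rewrite -mul_inM -inM_mul inM_comul_r1 inM_comul_l2 mulrA.
by rewrite rslice_mulLeft.
Qed.

(** Slicing the first leg of strong left invariance by w turns it into an
    adjointness relation for phi, phi(p w(S^-1(x_1)) x_2) = phi(w(p_1) p_2 x). *)
Lemma leg_adjoint (w : A -> K) p x z z' : scalar w ->
  lleg (fun q => w (S' q)) x (inM z) -> lleg w p (inM z') ->
  phi (p ** z) = phi (z' ** x).
Proof.
move=> wl hz hz'.
have S'l : linear S' by move=> c u v; rewrite linearP.
have wS'l : scalar (fun q => w (S' q)) := scalar_comp wl S'l.
have -> : p ** z = lslice (fun q => w (S' q)) (comul_l2 p x).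
  apply: nmul_cancel_r => y; rewrite -nmulA (llegE y wS'l hz).
  have -> : p ** lslice (fun q => w (S' q)) (comul_r2 x y) =
      lslice (fun q => w (S' q)) (mulLeft (tensM 1 (inM p)) (comul_r2 x y)).
    by rewrite lslice_mulLeft.
  have -> : mulLeft (tensM 1 (inM p)) (comul_r2 x y) =
      mulRight (tensM 1 (inM y)) (comul_l2 p x).
    by apply: inM2_inj; rewrite -mul_inM -inM_mul inM_comul_r2 inM_comul_l2 mulrA.
  by rewrite lslice_mulRight.
rewrite (llegE x wl hz') !slice_slice // strong_left_invariance_slices.
by have [[-> _] _ _ _ _] := S_antipode.
Qed.

(** The leg is known through its products z y, so a y with eps(y) != 0 is divided
    out; if there is none, A is zero. *)
Lemma counit_leg (w : A -> K) x z : scalar w -> lleg w x (inM z) -> eps z = w x.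
Proof.
move=> wl hz; have [epsM _ _] := eps_counit.
have slice y : rslice eps (comul_r2 x y) = eps y *: x.
  apply: nmul_cancel_l => c.
  have -> : c ** rslice eps (comul_r2 x y) =
      rslice eps (mulLeft (tensM (inM c) 1) (comul_r2 x y)) by rewrite rslice_mulLeft.
  have -> : mulLeft (tensM (inM c) 1) (comul_r2 x y) =
      mulRight (tensM 1 (inM y)) (comul_l1 c x).
    by apply: inM2_inj; rewrite -mul_inM -inM_mul inM_comul_r2 inM_comul_l1 mulrA.
  have [Al Ar] := @nmul_bilin K A.
  rewrite rslice_mulRight //= (linZ (Ar c)) -rslice_counit.
  rewrite /rslice /tlift /formal_eval scaler_sumr; apply: eq_bigr => i _.
  by rewrite epsM mulrC scalerA.
have epsE y : eps z * eps y = w x * eps y.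
  rewrite -epsM (llegE y wl hz) slice_slice // slice (linZ (V := K^o) wl).
  by rewrite /GRing.scale /= mulrC.
have [[y y0]|eps0] := pselect (exists y, eps y != 0).
  exact: (mulIf y0).
have {}eps0 y : eps y = 0.
  by apply/eqP/negPn/negP => h; apply: eps0; exists y.
suff -> : x = 0 by rewrite eps0 (lin0 (V := K^o) wl).
apply: (@mhs_nondegenerate K A).1 => y.
rewrite -lslice_counit /lslice /tlift /formal_eval big1 // => i _.
by rewrite eps0 scale0r.
Qed.

End Integrals.

(** * The Fourier transform and the Plancherel formula *)

Section Polarization.
Variables (K : numClosedFieldType) (V : lmodType K).

Definition sesquilinear (q : V -> V -> K) :=
  (forall v, scalar (q^~ v)) /\
  (forall u c v w, q u (c *: v + w) = c^* * q u v + q u w).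

Lemma polarization (q q' : V -> V -> K) : sesquilinear q -> sesquilinear q' ->
  (forall u, q u u = q' u u) -> forall u v, q u v = q' u v.
Proof.
move=> [ql qr] [ql' qr'] e u v.
pose h x y := q x y - q' x y.
have hl c x y z : h (c *: x + y) z = c * h x z + h y z.
  by rewrite /h ql ql' mulrBr opprD addrACA.
have hr x c y z : h x (c *: y + z) = c^* * h x y + h x z.
  by rewrite /h qr qr' mulrBr opprD addrACA.
have h0 x : h x x = 0 by rewrite /h e subrr.
(* Comparing the values at c u + v for c = 1 and c = i separates the two cross
   terms. *)
have cross c : c * h u v + c^* * h v u = 0.
  by have := h0 (c *: u + v); rewrite hl !hr !h0 mulr0 add0r addr0.
have h1 : h v u = - h u v.
  by have := cross 1; rewrite conjC1 !mul1r => /eqP; rewrite addrC addr_eq0 => /eqP.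
have := cross 'i; rewrite conjCi h1 mulrNN -mulr2n => /eqP.
by rewrite mulrn_eq0 /= mulf_eq0 (negbTE (neq0Ci K)) subr_eq0 => /eqP.
Qed.

End Polarization.

Section Fourier.
Variables (K : numClosedFieldType) (A B : multHopfStarType K).
Variables (epsA : {scalar A}) (SA SA' : {linear A -> A}) (SB' : B -> B).
Hypotheses (epsA_counit : is_counit epsA) (SA_antipode : is_antipode epsA SA SA').
Variables (phi : {scalar A}) (pair : A -> B -> K) (F : A -> B).
Hypotheses (phi_left : left_integral phi) (phi_pos : positive_functional phi).
Hypothesis pair_dual : is_dual phi SA SB' pair.
Hypothesis F_def : forall a x, pair x (F a) = phi (x ** a).
Let phil : scalar phi. Proof. by move=> c x y; rewrite linearP. Qed.
Let SA'l : linear SA'. Proof. by move=> c x y; rewrite linearP. Qed.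

Lemma phi_sesquilinear : sesquilinear (fun x' x => phi (star x ** x')).
Proof.
have [Al Ar] := @nmul_bilin K A.
split=> [x c u v|x' c u v]; first by rewrite Ar phil.
by rewrite star_semilinear Al phil.
Qed.

Lemma phi_hermitian x x' : (phi (star x ** x'))^* = phi (star x' ** x).
Proof.
have [ql qr] := phi_sesquilinear.
apply: (polarization (q := fun x x' => (phi (star x ** x'))^*) _ phi_sesquilinear).
  split=> [v c u w|u c v w] /=; first by rewrite qr rmorphD rmorphM /= conjCK.
  by rewrite ql rmorphD rmorphM.
by move=> u; apply/CrealP; exact: ger0_real.
Qed.

Lemma pair_ext b b' : (forall a, pair a b = pair a b') -> b = b'.
Proof.
move=> h; apply/eqP; rewrite -subr_eq0; apply/eqP/(dual_faithful pair_dual) => a.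
have pl := dual_linr pair_dual a.
by rewrite -scaleN1r addrC pl h mulN1r addNr.
Qed.

Lemma fourier_linear : linear F.
Proof.
have [Al Ar] := @nmul_bilin K A.
move=> c x y; apply: pair_ext => a.
by rewrite (dual_linr pair_dual) !F_def Ar phil.
Qed.

Lemma fourier_surjective b : exists a, b = F a.
Proof.
have [h _] := dual_range pair_dual (pair^~ b).
have [a e] := h (ex_intro _ b erefl); exists a; apply: pair_ext => x.
by rewrite F_def; exact: (congr1 (fun f => f x) e).
Qed.

(** <a, y_1> y_2 at y = F(x) is the functional p |-> phi(p a x). *)
Lemma fourier_mul_leg a x z : lleg (pair a) (F x) (inM z) -> z = F (a ** x).
Proof.
move=> hz; have [z' hz' e] := dual_comul pair_dual a (F x).
rewrite (lleg_unique (dual_linr pair_dual a) hz hz').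
by apply: pair_ext => p; rewrite -e !F_def nmulA.
Qed.

(** Paired with p, the product b F(x) gives <p_1, b> phi(p_2 x), to which
    leg_adjoint applies. *)
Lemma fourier_leg_mul b x z :
  lleg (fun p => pair (SA' p) b) x (inM z) -> F z = b ** F x.
Proof.
move=> hz; apply: pair_ext => p.
have [z' hz' ->] := dual_mul pair_dual p b.
rewrite !F_def.
exact: (leg_adjoint epsA_counit SA_antipode phi_left (dual_linl pair_dual b)).
Qed.

Variable phiB : {scalar B}.
Hypothesis phiB_norm : forall a, phiB (F a) = epsA a.

(** F(x)^* F(x') is F of a leg of x', whose counit is <S^-1(x'), F(x)^*>; the
    involution of B turns it into the conjugate of phi(x'^* x). *)
Lemma plancherel x x' :
  (exists z, lleg (fun p => pair (SA' p) (star (F x))) x' (inM z)) ->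
  phiB (star (F x) ** F x') = phi (star x ** x').
Proof.
case=> z hz; rewrite -(fourier_leg_mul hz) phiB_norm.
have wl : scalar (fun p => pair (SA' p) (star (F x))).
  exact: scalar_comp (dual_linl pair_dual _) SA'l.
rewrite (counit_leg epsA_counit wl hz) (dual_star pair_dual).
have [[_ -> ] _ _ _ _] := SA_antipode.
by rewrite F_def phi_hermitian.
Qed.

End Fourier.

(** * Isometric extension from a dense subspace *)

Section DenseExtension.
Variables (K : numFieldType) (V : lmodType K) (H : normedModType K).
Variable e : {linear V -> H}.
Hypothesis e_dense : dense (range e).

Lemma near_dense (u : H) (P : set H) : (\forall x \near u, P x) -> exists a, P (e a).
Proof.
move=> uP; have : nbhs u P := uP; rewrite nbhsE => -[N [No Nu] NP].
have [x [Nx [a _ ax]]] := e_dense (ex_intro _ u Nu) No.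
by exists a; apply: NP; rewrite ax.
Qed.

Lemma near_dist (u : H) (d : K) : 0 < d -> \forall x \near u, `|u - x| < d.
Proof. by move=> d0; apply/nbhs_normP; exists d. Qed.

Lemma dense_approx (u : H) (d : K) : 0 < d -> exists a, `|u - e a| < d.
Proof. by move=> /(near_dist u)/near_dense. Qed.

Lemma norm_small (W : normedModType K) (x : W) :
  (forall d, 0 < d -> `|x| < d) -> x = 0.
Proof.
move=> h; apply/eqP/negPn/negP => x0.
by have := h `|x|; rewrite normr_gt0 x0 ltxx => /(_ isT).
Qed.

(** In a field that is only partially ordered the bounds need not be comparable
    with 0, so they are first replaced by their absolute values. *)
Lemma bounded_dense_eq (W : normedModType K) (T T' : {linear H -> W}) (M M' : K) :
  (forall u, `|T u| <= M * `|u|) -> (forall u, `|T' u| <= M' * `|u|) ->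
  (forall a, T (e a) = T' (e a)) -> T =1 T'.
Proof.
have absb (L : {linear H -> W}) N : (forall u, `|L u| <= N * `|u|) ->
    forall u, `|L u| <= `|N| * `|u|.
  move=> h u; rewrite -[`|u| in leRHS]normr_id -normrM ger0_norm //.
  exact: le_trans (h u).
move=> /absb hT /absb hT' TT' u; apply/eqP; rewrite -subr_eq0; apply/eqP.
apply: norm_small => d d0; pose N := `|M| + `|M'| + 1.
have N0 : 0 < N by rewrite ltr_wpDl // addr_ge0.
have [a ua] := dense_approx u (divr_gt0 d0 N0).
have -> : T u - T' u = T (u - e a) - T' (u - e a).
  by rewrite (linearB T) (linearB T') /= TT' opprB addrA addrNK.
apply: le_lt_trans (ler_normB _ _) _.
apply: le_lt_trans (lerD (hT _) (hT' _)) _.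
rewrite -mulrDl; apply: (@le_lt_trans _ _ (N * `|u - e a|)).
  by rewrite ler_wpM2r // lerDl.
by rewrite mulrC -ltr_pdivlMr.
Qed.

Variables (W : completeNormedModType K) (g : {linear V -> W}).
Hypothesis ge : forall a, `|g a| = `|e a|.

(** The closure of the set of pairs (e a, g a), which is the graph of the extension
    of g along e: membership is stable under linear combinations and preserves
    norms, so linearity and isometry of the extension need no limits. *)
Definition graph_closure (u : H) (v : W) :=
  forall d, 0 < d -> exists a, `|u - e a| < d /\ `|v - g a| < d.

Lemma graph_closure_linear c u v u' v' :
  graph_closure u v -> graph_closure u' v' ->
  graph_closure (c *: u + u') (c *: v + v').
Proof.
move=> h h' d d0; have c0 : 0 < `|c| + 1 by rewrite ltr_wpDl.
have [a [ua va]] := h _ (divr_gt0 d0 c0).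
have [a' [ua' va']] := h' _ (divr_gt0 d0 c0).
have bound (X : normedModType K) (x x' : X) :
    `|x| < d / (`|c| + 1) -> `|x'| < d / (`|c| + 1) -> `|c *: x + x'| < d.
  move=> xd xd'; apply: le_lt_trans (ler_normD _ _) _.
  rewrite normrZ -[ltRHS](divfK (lt0r_neq0 c0)) mulrDr mulr1 mulrC.
  by apply: ler_ltD => //; rewrite ler_wpM2r // ltW.
exists (c *: a + a'); rewrite (linearP e) (linearP g) !opprD.
by split; rewrite addrACA -scalerBr; exact: bound.
Qed.

Lemma graph_closure_norm u v : graph_closure u v -> `|v| = `|u|.
Proof.
move=> h; apply/eqP; rewrite -subr_eq0; apply/eqP.
apply: (@norm_small K^o) => d d0.
have d20 : 0 < d / 2 by rewrite divr_gt0.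
have [a [ua va]] := h _ d20.
have -> : `|v| - `|u| = (`|v| - `|g a|) - (`|u| - `|e a|).
  by rewrite ge opprB addrA addrNK.
rewrite [ltRHS]splitr.
apply: le_lt_trans (ler_normB _ _) (ltrD _ _).
  exact: le_lt_trans (ler_dist_dist _ _) va.
exact: le_lt_trans (ler_dist_dist _ _) ua.
Qed.

(** The images under g of the a with e a near u form a Cauchy filter. *)
Lemma graph_closure_total u : exists v, graph_closure u v.
Proof.
pose G : set_system W := [set S | \forall x \near u, forall a, e a = x -> S (g a)]%classic.
have GF : ProperFilter G.
  have G0 : ~ G set0 by move=> /near_dense [a /(_ a erefl)].
  apply: Build_ProperFilter G0 _; split.
  - exact: nearW.
  - by move=> P Q GP GQ; rewrite /G /=; near=> x => a ax; split; move: a ax; near: x.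
  by move=> P Q PQ GP; rewrite /G /=; near=> x => a ax; apply: PQ; move: a ax; near: x.
have Gc : cauchy G.
  apply/cauchy_exP => d d0; have d20 : 0 < d / 2 by rewrite divr_gt0.
  have [a0 ua0] := dense_approx u d20.
  exists (g a0); rewrite /G /=; near=> x => a ax.
  rewrite -ball_normE /= -(linearB g) ge (linearB e) /= ax.
  rewrite -[e a0](addrNK u) -addrA [d]splitr.
  apply: le_lt_trans (ler_normD _ _) (ltrD _ _); first by rewrite distrC.
  by near: x; exact: near_dist.
have Gv : (G --> lim G)%classic := cauchy_cvg G Gc; exists (lim G) => d d0.
have /Gv Gb : nbhs (lim G) (ball (lim G) d) by exact: nbhsx_ballx.
pose P x := `|u - x| < d /\ (forall b, e b = x -> ball (lim G) d (g b)).
have [a [ua va]] : exists a, P (e a).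
  apply: (@near_dense u P).
  by near=> x; split; near: x; [exact: near_dist|exact: Gb].
by exists a; split=> //; have := va a erefl; rewrite -ball_normE.
Unshelve. all: by end_near. Qed.

Lemma isometric_extension :
  exists U : {linear H -> W}, (forall a, U (e a) = g a) /\ (forall u, `|U u| = `|u|).
Proof.
pose U u := sval (cid (graph_closure_total u)).
have UP u : graph_closure u (U u) by rewrite /U; case: cid.
have uniq u v v' : graph_closure u v -> graph_closure u v' -> v = v'.
  move=> h h'; apply/eqP; rewrite -subr_eq0 -normr_eq0.
  have := graph_closure_norm (graph_closure_linear (-1) h' h).
  by rewrite !scaleN1r addNr normr0 addrC => ->.
have Ul : linear U.
  by move=> c u v; apply: uniq (UP _) _; exact: graph_closure_linear.
pose UL := GRing.isLinear.Build K H W *:%R U Ul.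
exists (HB.pack_for {linear H -> W} U UL); split=> [a|u] /=.
  apply: uniq (UP _) _ => d d0; exists a.
  by rewrite !subrr !normr0.
exact: graph_closure_norm.
Qed.

End DenseExtension.

(** * Extension to the completions *)

Theorem proposition4p3 (R : realType) (A B : multHopfStarType R[i])
    (epsA : {scalar A}) (SA SA' : {linear A -> A})
    (epsB : {scalar B}) (SB SB' : {linear B -> B})
    (epsA_counit : is_counit epsA) (SA_antipode : is_antipode epsA SA SA')
    (epsB_counit : is_counit epsB) (SB_antipode : is_antipode epsB SB SB')
    (phi : {scalar A})
    (phi_left : left_integral phi) (phi_pos : positive_functional phi)
    (right_pos : exists psi : {scalar A},
       right_integral psi /\ positive_functional psi)
    (pair : A -> B -> R[i]) (pair_dual : is_dual phi SA SB' pair)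
    (F : A -> B) (F_def : forall a x, pair x (F a) = phi (x ** a))
    (phiB : {scalar B})
    (phiB_left : left_integral phiB) (phiB_pos : positive_functional phiB)
    (phiB_norm : forall a, phiB (F a) = epsA a)
    (H : completeNormedModType R[i])
    (ip : {dot H for Num.conj}) (eta : {linear A -> H})
    (H_GNS : is_GNS phi ip eta)
    (Hh : completeNormedModType R[i])
    (iph : {dot Hh for Num.conj}) (etah : {linear B -> Hh})
    (Hh_GNS : is_GNS phiB iph etah)
    (piA : A -> {linear H -> H}) (lambdaB : B -> {linear H -> H})
    (piB : B -> {linear Hh -> Hh}) (lambdaA : A -> {linear Hh -> Hh})
    (piA_def : forall a, is_mult_operator eta a (piA a))
    (lambdaB_def : forall b,
       is_leg_operator eta (fun p => pair (SA' p) b) (lambdaB b))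
    (piB_def : forall b, is_mult_operator etah b (piB b))
    (lambdaA_def : forall a, is_leg_operator etah (pair a) (lambdaA a)) :
  exists (U : {linear H -> Hh}) (V : {linear Hh -> H}),
    [/\ cancel U V /\ cancel V U,
        forall u v, iph (U u) (U v) = ip u v,
        forall a, U (eta a) = etah (F a),
        forall a u, U (piA a (V u)) = lambdaA a u &
        forall b u, U (lambdaB b (V u)) = piB b u].
Proof.
have legB b x : exists2 z, lleg (fun p => pair (SA' p) b) x (inM z) &
    lambdaB b (eta x) = eta z by exact: (lambdaB_def b).2.
have norm2 (a : A) : `|etah (F a)| = `|eta a|.
  apply/eqP; rewrite -(@eqrXn2 _ 2) // -(gns_norm Hh_GNS) -(gns_norm H_GNS).
  rewrite (gns_form Hh_GNS) (gns_form H_GNS).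
  rewrite (plancherel epsA_counit SA_antipode phi_left phi_pos pair_dual F_def) //.
  by have [z hz _] := legB (star (F a)) a; exists z.
have Fl : linear F := fourier_linear pair_dual F_def.
have etaFl : linear (etah \o F) by move=> c x y /=; rewrite Fl linearP.
pose etaFL := GRing.isLinear.Build _ _ _ _ (etah \o F) etaFl.
pose etaF : {linear A -> Hh} := HB.pack_for {linear A -> Hh} (etah \o F) etaFL.
have etaF_dense : dense (range etaF).
  have -> : range etaF = range etah; last exact: gns_dense Hh_GNS.
  apply/seteqP; split=> [_ [a _ <-]|_ [b _ <-]]; first by exists (F a).
  by have [a ->] := fourier_surjective pair_dual F_def b; exists a.
(* The inverse of U is the isometric extension in the opposite direction. *)
have [U [Ueta Unorm]] := isometric_extension (gns_dense H_GNS) (g := etaF) norm2.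
have [V [Veta Vnorm]] :=
  isometric_extension etaF_dense (g := eta) (fun a => esym (norm2 a)).
have Ub u : `|U u| <= 1 * `|u| by rewrite mul1r Unorm.
have Vb u : `|V u| <= 1 * `|u| by rewrite mul1r Vnorm.
have idb (W : normedModType R[i]) (u : W) : `|u| <= 1 * `|u| by rewrite mul1r.
have conj_bounded (T : {linear H -> H}) : bounded_operator T ->
    exists M, forall u, `|(U \o T \o V) u| <= M * `|u|.
  by case=> M TM; exists M => u /=; rewrite Unorm -(Vnorm u).
exists U, V; split; first split.
- apply: (bounded_dense_eq (gns_dense H_GNS) (T := V \o U) (T' := idfun)) => [u||a].
  + by rewrite /= Vnorm; exact: Ub.
  + exact: idb.
  by rewrite /= Ueta Veta.
- apply: (bounded_dense_eq etaF_dense (T := U \o V) (T' := idfun)) => [u||a].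
  + by rewrite /= Unorm; exact: Vb.
  + exact: idb.
  by rewrite /= Veta Ueta.
- apply: polarization => [||u].
  + split=> [v c x y|u c v w]; first by rewrite linearP linearPl.
    by rewrite linearP linearPr.
  + split=> [v c x y|u c v w]; first by rewrite linearPl.
    by rewrite linearPr.
  by rewrite (gns_norm Hh_GNS) (gns_norm H_GNS) Unorm.
- exact: Ueta.
- move=> a; have [[M' TM'] lamE] := lambdaA_def a; have [pib piE] := piA_def a.
  have [M TM] := conj_bounded _ pib.
  apply: (bounded_dense_eq etaF_dense (T := U \o piA a \o V) TM TM') => x.
  rewrite /= Veta piE Ueta /=; have [z hz ->] := lamE (F x).
  by rewrite (fourier_mul_leg pair_dual F_def hz).
move=> b; have [[M' TM'] piE] := piB_def b; have [lamb _] := lambdaB_def b.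
have [M TM] := conj_bounded _ lamb.
apply: (bounded_dense_eq etaF_dense (T := U \o lambdaB b \o V) TM TM') => x.
rewrite /= Veta piE; have [z hz ->] := legB b x.
by rewrite Ueta /= (fourier_leg_mul epsA_counit SA_antipode phi_left pair_dual F_def hz).
Qed.
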